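(* There exist smooth complex-valued functions $C(z,s,t)$ and $D(z,s,t)$ defined near the origin of $\mathbb C_z\times\mathbb R_s\times\mathbb R_t$, giving the vector field $$L=\frac{\partial}{\partial\bar z}+C(z,s,t)\frac{\partial}{\partial s}+t\,D(z,s,t)\frac{\partial}{\partial t},\qquad L^0=L|_{t=0}=\frac{\partial}{\partial\bar z}+C(z,s,0)\frac{\partial}{\partial s},$$ and a (complex-valued) real analytic function $h=h(z,s)$ defined near the origin with $L^0(h)=0$, such that the equation $$L(h+tg)=0$$ has no solution $g=g(z,s,t)$ of class $C^1$ (in any neighborhood of the origin).
   Context: Coordinates are $z\in\mathbb C$, $s\in\mathbb R$, $t\in\mathbb R$, and $\partial/\partial\bar z$ is the usual Cauchy–Riemann operator. $L^0$ acts on functions of $(z,s)$. The unknown $g$ is complex-valued. *)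

(* Defs.v *)
From Stdlib Require Import Reals.
From Coquelicot Require Import Coquelicot.

Open Scope R_scope.

(** All derivatives below are with respect to real variables; complex values
    are differentiated componentwise.  [Coquelicot]'s [C_derive], the
    holomorphic derivative, is not used. *)
Definition RCderive (f : R -> C) (x : R) : C :=
  (Derive (fun u => Re (f u)) x, Derive (fun u => Im (f u)) x).

Definition ex_RCderive (f : R -> C) (x : R) : Prop :=
  ex_derive (V := C_R_NormedModule) f x.

(** [d/d(bar z) = (d/dx + i d/dy) / 2] for [z = x + i y]. *)
Definition dzbar (f : C -> C) (z : C) : C :=
  (/ 2 * (RCderive (fun u => f (u, Im z)) (Re z)
          + Ci * RCderive (fun v => f (Re z, v)) (Im z)))%C.

Definition Dx (f : C -> R -> R -> C) (z : C) (s t : R) : C :=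
  RCderive (fun u => f (u, Im z) s t) (Re z).
Definition Dy (f : C -> R -> R -> C) (z : C) (s t : R) : C :=
  RCderive (fun v => f (Re z, v) s t) (Im z).
Definition Ds (f : C -> R -> R -> C) (z : C) (s t : R) : C :=
  RCderive (fun r => f z r t) s.
Definition Dt (f : C -> R -> R -> C) (z : C) (s t : R) : C :=
  RCderive (fun r => f z s r) t.

Definition partials_exist (f : C -> R -> R -> C) (z : C) (s t : R) : Prop :=
  ex_RCderive (fun u => f (u, Im z) s t) (Re z) /\
  ex_RCderive (fun v => f (Re z, v) s t) (Im z) /\
  ex_RCderive (fun r => f z r t) s /\
  ex_RCderive (fun r => f z s r) t.

(** Class [C^k] (in the real sense) on [U], meant for open [U].  For [k > 0]
    continuity of [f] itself follows from that of its partial derivatives. *)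
Fixpoint Ck_on (k : nat) (U : C * R * R -> Prop) (f : C -> R -> R -> C)
    {struct k} : Prop :=
  match k with
  | O => forall (z : C) (s t : R), U (z, s, t) ->
      continuous (U := C_UniformSpace)
        (fun p : C * R * R => f (fst (fst p)) (snd (fst p)) (snd p)) (z, s, t)
  | S k' =>
      (forall (z : C) (s t : R), U (z, s, t) -> partials_exist f z s t) /\
      Ck_on k' U (Dx f) /\ Ck_on k' U (Dy f) /\
      Ck_on k' U (Ds f) /\ Ck_on k' U (Dt f)
  end.

Definition smooth_on (U : C * R * R -> Prop) (f : C -> R -> R -> C) : Prop :=
  forall k : nat, Ck_on k U f.

(** Sum of [c i j k] over all [i + j + k = n]. *)
Definition sum_deg {G : AbelianMonoid} (c : nat -> nat -> nat -> G) (n : nat) : G :=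
  sum_n (fun i => sum_n (fun j => c i j (n - i - j)%nat) (n - i)%nat) n.

(** Near [(z0, s0)], [h] is the sum of an absolutely convergent power series
    in the three real variables [x - x0], [y - y0], [s - s0]; terms are
    grouped by total degree. *)
Definition real_analytic_at (h : C -> R -> C) (z0 : C) (s0 : R) : Prop :=
  exists (a : nat -> nat -> nat -> C) (rho : R), 0 < rho /\
    forall dx dy ds : R, Rabs dx < rho -> Rabs dy < rho -> Rabs ds < rho ->
      ex_series (V := R_NormedModule)
        (sum_deg (fun i j k =>
           Cmod (a i j k) * (Rabs dx ^ i * Rabs dy ^ j * Rabs ds ^ k))) /\
      is_series (V := C_R_NormedModule)
        (sum_deg (G := C_R_NormedModule) (fun i j k =>
           Cmult (a i j k) (RtoC (dx ^ i * dy ^ j * ds ^ k))))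
        (h (Re z0 + dx, Im z0 + dy) (s0 + ds)).

Definition real_analytic_on (W : C * R -> Prop) (h : C -> R -> C) : Prop :=
  forall (z : C) (s : R), W (z, s) -> real_analytic_at h z s.

(** [L = d/d(bar z) + A d/ds + t B d/dt]. *)
Definition Lop (A B : C -> R -> R -> C) (f : C -> R -> R -> C)
    (z : C) (s t : R) : C :=
  (dzbar (fun w => f w s t) z + A z s t * Ds f z s t
   + t * B z s t * Dt f z s t)%C.

(** [L^0 = L] at [t = 0], acting on functions of [(z, s)]. *)
Definition L0op (A : C -> R -> R -> C) (f : C -> R -> C) (z : C) (s : R) : C :=
  (dzbar (fun w => f w s) z + A z s 0 * RCderive (fun r => f z r) s)%C.

(* Main.v *)
Require Import Defs.
From Stdlib Require Import Reals Lra Lia ClassicalEpsilon FunctionalExtensionality.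
From Coquelicot Require Import Coquelicot.
Open Scope R_scope.

(** This is Lewy's example: [A = - i z + t f(s)], [B = 0], [h = s + i |z|^2] and
    [f = F'] with [F(s) = exp (- 1 / s)] for [s > 0], [F(s) = 0] otherwise.  Dividing
    [L (h + t g) = 0] by [t] and letting [t] tend to [0] gives a [C^1] solution
    [u = - g(z, s, 0)] of [du/d(bar z) - i z du/ds = f(s)].  Integrating [u dz] over the
    circle [|z| = rho] turns this into a function [Y = X - 2 pi i F(s)] that is holomorphic
    in [w = s + i rho^2] for [rho > 0] and equals [- 2 pi i F(s)] on [rho = 0].  Testing
    [Y] by Cauchy's theorem against [exp (k / (w + delta + i eta))], [k -> oo], whose
    singularity lies where [F] vanishes, contradicts [F > 0] on the right of [0]. *)

(** * Integrals with a parameter *)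

(** The flat term of [A] produces the source: since [h] has [s]-derivative 1, it contributes
    [t f(s)], and [L^0 h = 0] leaves nothing of order zero in [t]. A holomorphic [Y] whose real part
    vanishes on the axis, and whose imaginary part vanishes on half of it, is zero by Schwarz
    reflection and the identity theorem. The proof makes this quantitative on a rectangle, so that
    only real derivatives, integrals with a parameter and the mean value theorem occur. The radius
    [rho] is kept as coordinate in place of [rho^2]: the equation [Y_rho = 2 i rho Y_s] is regular
    at [rho = 0] and makes sense for [rho < 0], so the axis is interior to the domain and all
    derivatives there are two-sided. For a test function [H], the axis contributes [F Re H]. Left of
    0, where [H] is largest, [F] annihilates it; right of 0 it has a sign only if the phase of [H]
    is controlled. The pole must therefore approach the axis as [k] grows, with [eta] proportional
    to [1 / k]. *)

Lemma uniform_param {T : UniformSpace} (f : T -> R -> R) (x0 : T) (a b : R) :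
  (forall t, a <= t <= b ->
     continuous (fun p : T * R => f (fst p) (snd p)) (x0, t)) ->
  forall eps : posreal, locally x0 (fun x => forall t, a <= t <= b ->
    Rabs (f x t - f x0 t) < eps).
Proof.
  intros Hc eps.
  assert (Hd : forall t, exists d : posreal, a <= t <= b ->
      forall x u, ball x0 d x -> Rabs (u - t) < d ->
        Rabs (f x u - f x0 t) < eps / 2).
  { intros t.
    destruct (classic (a <= t <= b)) as [Ht | Ht].
    - destruct (Hc t Ht (ball (f x0 t) (pos_div_2 eps))
        (locally_ball _ _)) as [d Hd].
      exists d; intros _ x u Hx Hu.
      exact (Hd (x, u) (conj Hx Hu)).
    - exists eps; intros H; contradiction. }
  (* Tube argument by compactness of [[a, b]]. [compactness_value_1d] takes a radius function on all
     of [R], hence the choice and the arbitrary radius off [[a, b]]; its conclusion is doubly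
     negated, hence [NNPP] below. *)
  pose (delta := fun t => proj1_sig (constructive_indefinite_description _ (Hd t))).
  assert (Hdelta := fun t => proj2_sig (constructive_indefinite_description _ (Hd t))).
  fold delta in Hdelta.
  destruct (compactness_value_1d a b delta) as [d Hcomp].
  exists d; intros x Hx t Ht.
  apply NNPP; intros Hn; apply (Hcomp t Ht); intros (u & Hu & Htu & Hdu).
  apply Hn.
  assert (H1 : Rabs (f x t - f x0 u) < eps / 2).
  { apply (Hdelta u Hu); [ apply ball_le with d; trivial | exact Htu ]. }
  assert (H2 : Rabs (f x0 t - f x0 u) < eps / 2).
  { apply (Hdelta u Hu); [ apply ball_center | exact Htu ]. }
  apply Rabs_def2 in H1; apply Rabs_def2 in H2; apply Rabs_def1; lra.
Qed.

Lemma continuous_pair {T U V : UniformSpace} (f : T -> U) (g : T -> V) (x : T) :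
  continuous f x -> continuous g x -> continuous (fun y => (f y, g y)) x.
Proof.
  intros Hf Hg; apply (continuous_comp_2 f g (fun u v => (u, v))); trivial.
  apply continuous_ext with (fun p : U * V => p).
  - now intros [? ?].
  - apply continuous_id.
Qed.

Lemma continuous_section {T U V : UniformSpace} (f : T -> U -> V) (x : T) (t : U) :
  continuous (fun p : T * U => f (fst p) (snd p)) (x, t) -> continuous (f x) t.
Proof.
  apply (continuous_comp (fun u => (x, u)) (fun p : T * U => f (fst p) (snd p))).
  apply continuous_pair; [ apply continuous_const | apply continuous_id ].
Qed.

Lemma continuous_section_l {T U V : UniformSpace} (f : T -> U -> V) (x : T) (t : U) :
  continuous (fun p : T * U => f (fst p) (snd p)) (x, t) ->
  continuous (fun y => f y t) x.
Proof.
  apply (continuous_comp (fun u => (u, t)) (fun p : T * U => f (fst p) (snd p))).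
  apply continuous_pair; [ apply continuous_id | apply continuous_const ].
Qed.

Lemma continuous_RInt_param {T : UniformSpace} (f : T -> R -> R) (x0 : T) (a b : R) :
  a <= b ->
  locally x0 (fun x => forall t, a <= t <= b ->
     continuous (fun p : T * R => f (fst p) (snd p)) (x, t)) ->
  continuous (fun x => RInt (f x) a b) x0.
Proof.
  intros Hab Hc.
  assert (Hex : locally x0 (fun x => ex_RInt (f x) a b)).
  { apply filter_imp with (2 := Hc); intros x Hx.
    apply (ex_RInt_continuous (V := R_CompleteNormedModule)); rewrite Rmin_left, Rmax_right by lra.
    intros t Ht; apply continuous_section, Hx, Ht. }
  apply filterlim_locally; intros eps.
  (* The added 1 keeps the denominator positive when [a = b]. *)
  assert (He : 0 < eps / (b - a + 1)).
  { apply Rdiv_lt_0_compat; [ apply cond_pos | lra ]. }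
  generalize (uniform_param f x0 a b (locally_singleton _ _ Hc) (mkposreal _ He)).
  intros Hu.
  assert (Hx0 := locally_singleton _ _ Hex).
  generalize (filter_and _ _ Hex Hu); apply filter_imp; intros x [Hx Hclose].
  change (Rabs (RInt (f x) a b - RInt (f x0) a b) < eps).
  replace (RInt (f x) a b - RInt (f x0) a b)
    with (RInt (fun t => f x t - f x0 t) a b)
    by (apply (RInt_minus (V := R_CompleteNormedModule)); assumption).
  apply Rle_lt_trans with ((b - a) * (eps / (b - a + 1))).
  - apply abs_RInt_le_const; [ lra | now apply (ex_RInt_minus (V := R_NormedModule) (f x) (f x0)) | ].
    intros t Ht; left; apply (Hclose t Ht).
  - assert (H := cond_pos eps).
    apply Rmult_lt_reg_r with (b - a + 1); [ lra | ].
    field_simplify; [ nra | lra ].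
Qed.

(* The margin [d] is there because [Derive] is taken on a two-dimensional
   neighbourhood of each [(x, t)], hence also for [t] slightly off [[a, b]]. *)
Lemma is_derive_RInt_param_margin (f df : R -> R -> R) (a b d x : R) :
  a <= b -> 0 < d ->
  locally x (fun y => forall t, a - d < t < b + d ->
    is_derive (fun u => f u t) y (df y t)) ->
  (forall t, a <= t <= b ->
    continuous (fun p : R * R => df (fst p) (snd p)) (x, t)) ->
  locally x (fun y => forall t, a <= t <= b -> continuous (f y) t) ->
  is_derive (fun y => RInt (f y) a b) x (RInt (df x) a b).
Proof.
  intros Hab Hd Hder Hdf Hf.
  replace (RInt (df x) a b) with (RInt (fun t => Derive (fun u => f u t) x) a b).
  apply (is_derive_RInt_param f a b x); rewrite ?Rmin_left, ?Rmax_right by lra.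
  - apply filter_imp with (2 := Hder); intros y Hy t Ht.
    exists (df y t); apply Hy; lra.
  - intros t Ht. apply continuity_2d_pt_filterlim.
    apply filterlim_ext_loc with (fun p : R * R => df (fst p) (snd p)).
    + destruct Hder as [r Hr].
      assert (Hm : 0 < Rmin r d) by (apply Rmin_pos; [ apply cond_pos | lra ]).
      exists (mkposreal _ Hm); intros [y u] [Hy Hu]; simpl.
      symmetry; apply is_derive_unique, Hr.
      * apply ball_le with (2 := Hy); apply Rmin_l.
      * assert (H : Rabs (u - t) < d).
        { apply Rlt_le_trans with (1 := Hu); apply Rmin_r. }
        apply Rabs_def2 in H; lra.
    + replace (Derive (fun z => f z t) x) with (df x t).
      * apply (Hdf t Ht).
      * symmetry; apply is_derive_unique, (locally_singleton _ _ Hder); lra.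
  - apply filter_imp with (2 := Hf); intros y Hy.
    apply (ex_RInt_continuous (V := R_CompleteNormedModule)).
    rewrite Rmin_left, Rmax_right by lra; exact Hy.
  - apply RInt_ext; rewrite Rmin_left, Rmax_right by lra; intros t Ht.
    apply is_derive_unique, (locally_singleton _ _ Hder); lra.
Qed.

Lemma locally_Rabs_lt (x e : R) : Rabs x < e -> locally x (fun y => Rabs y < e).
Proof.
  intros H.
  assert (Hd : 0 < e - Rabs x) by lra.
  exists (mkposreal _ Hd); intros y Hy.
  change (Rabs (y - x) < e - Rabs x) in Hy.
  replace y with (y - x + x) by ring.
  generalize (Rabs_triang (y - x) x); lra.
Qed.

Lemma continuous_bounded (f : R -> R) (a b : R) :
  a <= b -> (forall x, a <= x <= b -> continuous f x) ->
  exists M, 0 <= M /\ forall x, a <= x <= b -> Rabs (f x) <= M.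
Proof.
  intros Hab Hc.
  assert (Hc' : forall x, a <= x <= b -> continuity_pt (fun y => Rabs (f y)) x).
  { intros x Hx; apply continuity_pt_filterlim.
    apply (continuous_comp f Rabs); [ now apply Hc | apply continuous_Rabs ]. }
  destruct (continuity_ab_maj (fun y => Rabs (f y)) a b Hab Hc') as [m [Hm _]].
  exists (Rabs (f m)); split; [ apply Rabs_pos | exact Hm ].
Qed.

(** * Continuity of elementary real expressions *)

Lemma continuous_Rplus {T : UniformSpace} (f g : T -> R) (x : T) :
  continuous f x -> continuous g x -> continuous (fun y => f y + g y) x.
Proof. exact (continuous_plus (V := R_NormedModule) f g x). Qed.

Lemma continuous_Rminus {T : UniformSpace} (f g : T -> R) (x : T) :
  continuous f x -> continuous g x -> continuous (fun y => f y - g y) x.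
Proof. exact (continuous_minus (V := R_NormedModule) f g x). Qed.

Lemma continuous_Ropp {T : UniformSpace} (f : T -> R) (x : T) :
  continuous f x -> continuous (fun y => - f y) x.
Proof. exact (continuous_opp (V := R_NormedModule) f x). Qed.

Lemma continuous_Rmult {T : UniformSpace} (f g : T -> R) (x : T) :
  continuous f x -> continuous g x -> continuous (fun y => f y * g y) x.
Proof. exact (continuous_mult (K := R_AbsRing) f g x). Qed.

Lemma continuous_Rinv_comp {T : UniformSpace} (f : T -> R) (x : T) :
  continuous f x -> f x <> 0 -> continuous (fun y => / f y) x.
Proof.
  intros Hf Hx; apply (continuous_comp f Rinv); [ exact Hf | ].
  apply continuous_Rinv, Hx.
Qed.

Lemma continuous_derivable_comp {T : UniformSpace} (g : R -> R) (f : T -> R) (x : T) :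
  (forall y, ex_derive g y) -> continuous f x -> continuous (fun y => g (f y)) x.
Proof.
  intros Hg Hf; apply (continuous_comp f g); [ exact Hf | ].
  apply (ex_derive_continuous (V := R_NormedModule)), Hg.
Qed.

Lemma ex_derive_exp (y : R) : ex_derive exp y.
Proof. now auto_derive. Qed.

Lemma ex_derive_cos (y : R) : ex_derive cos y.
Proof. now auto_derive. Qed.

Lemma ex_derive_sin (y : R) : ex_derive sin y.
Proof. now auto_derive. Qed.

Ltac prove_continuous :=
  lazymatch goal with
  | |- continuous (fun _ => ?c) _ => apply continuous_const
  | |- continuous (fun x => x) _ => apply continuous_id
  | |- continuous fst _ => apply continuous_fst
  | |- continuous snd _ => apply continuous_snd
  | |- continuous (fun p => _ + _) _ => apply continuous_Rplus; prove_continuous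
  | |- continuous (fun p => _ - _) _ => apply continuous_Rminus; prove_continuous
  | |- continuous (fun p => - _) _ => apply continuous_Ropp; prove_continuous
  | |- continuous (fun p => _ * _) _ => apply continuous_Rmult; prove_continuous
  | |- continuous (fun p => / _) _ =>
      apply continuous_Rinv_comp; [ prove_continuous | ]
  | |- continuous (fun p => exp _) _ =>
      apply (continuous_derivable_comp exp); [ exact ex_derive_exp | prove_continuous ]
  | |- continuous (fun p => cos _) _ =>
      apply (continuous_derivable_comp cos); [ exact ex_derive_cos | prove_continuous ]
  | |- continuous (fun p => sin _) _ =>
      apply (continuous_derivable_comp sin); [ exact ex_derive_sin | prove_continuous ]
  | |- continuous (Rmult ?c) _ =>
      apply (continuous_Rmult (fun _ => c) (fun x => x)); prove_continuous
  | |- _ => try assumption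
  end.

(** * The test functions *)

(** This is [|zeta|^2] for [zeta = s + d + i (rho^2 + eta)]. It vanishes only if [rho^2 = - eta], so
    for [eta > 0] the pole of [1 / zeta] is never met, negative [rho] included. *)
Definition zeta_sq (d eta s rho : R) : R :=
  (s + d) * (s + d) + (rho * rho + eta) * (rho * rho + eta).

(* [kernel_re] and [kernel_im] are the real and imaginary parts of
   [exp (k / zeta)] with [zeta = s + d + i (rho^2 + eta)]. *)
Definition kernel_re (k d eta s rho : R) : R :=
  exp (k * ((s + d) * / zeta_sq d eta s rho))
  * cos (k * (- (rho * rho + eta) * / zeta_sq d eta s rho)).

Definition kernel_im (k d eta s rho : R) : R :=
  exp (k * ((s + d) * / zeta_sq d eta s rho))
  * sin (k * (- (rho * rho + eta) * / zeta_sq d eta s rho)).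

(** With [kernel_im_ds], the two parts of [- k / zeta^2 exp (k / zeta)], where [1 / zeta^2] is
    written as the squared conjugate of [zeta] over [|zeta|^4]. *)
Definition kernel_re_ds (k d eta s rho : R) : R :=
  k * (((rho * rho + eta) * (rho * rho + eta) - (s + d) * (s + d))
         * kernel_re k d eta s rho
       - 2 * (s + d) * (rho * rho + eta) * kernel_im k d eta s rho)
    * (/ zeta_sq d eta s rho * / zeta_sq d eta s rho).

Definition kernel_im_ds (k d eta s rho : R) : R :=
  k * (((rho * rho + eta) * (rho * rho + eta) - (s + d) * (s + d))
         * kernel_im k d eta s rho
       + 2 * (s + d) * (rho * rho + eta) * kernel_re k d eta s rho)
    * (/ zeta_sq d eta s rho * / zeta_sq d eta s rho).

Lemma zeta_sq_pos (d eta s rho : R) : 0 < eta -> 0 < zeta_sq d eta s rho.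
Proof.
  unfold zeta_sq; intros He.
  assert (Ht : 0 < rho * rho + eta) by nra.
  generalize (Rle_0_sqr (s + d)) (Rmult_lt_0_compat _ _ Ht Ht); unfold Rsqr; lra.
Qed.

(** The last two derivatives are the Cauchy-Riemann equations: a holomorphic function of
    [s + i rho^2] has [rho]-derivative [2 i rho] times its [s]-derivative. *)
Lemma kernel_derivatives (k d eta s rho : R) : 0 < eta ->
  is_derive (fun r => kernel_re k d eta r rho) s (kernel_re_ds k d eta s rho) /\
  is_derive (fun r => kernel_im k d eta r rho) s (kernel_im_ds k d eta s rho) /\
  is_derive (kernel_re k d eta s) rho (- (2 * rho) * kernel_im_ds k d eta s rho) /\
  is_derive (kernel_im k d eta s) rho (2 * rho * kernel_re_ds k d eta s rho).
Proof.
  intros He; assert (Hz := zeta_sq_pos d eta s rho He).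
  unfold kernel_re, kernel_im, kernel_re_ds, kernel_im_ds, kernel_re, kernel_im.
  unfold zeta_sq in *.
  split; [ | split; [ | split ] ]; auto_derive; try lra;
  set (E := exp _); set (Co := cos _); set (Si := sin _); field; lra.
Qed.

Lemma kernel_continuous (k d eta s rho : R) : 0 < eta ->
  continuous (fun p : R * R => kernel_re k d eta (fst p) (snd p)) (s, rho) /\
  continuous (fun p : R * R => kernel_im k d eta (fst p) (snd p)) (s, rho) /\
  continuous (fun p : R * R => kernel_re_ds k d eta (fst p) (snd p)) (s, rho) /\
  continuous (fun p : R * R => kernel_im_ds k d eta (fst p) (snd p)) (s, rho).
Proof.
  intros He; assert (Hz := zeta_sq_pos d eta s rho He).
  unfold kernel_re_ds, kernel_im_ds, kernel_re, kernel_im.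
  unfold zeta_sq in *.
  split; [ | split; [ | split ] ]; prove_continuous;
    apply Rgt_not_eq, Hz.
Qed.

(** The modulus of [exp (k / zeta)] is [exp (k Re (1 / zeta))], and the level sets of
    [Re (1 / zeta)] are circles through 0: the third hypothesis places [zeta] outside the open disc
    with diameter [[0, m]], where [Re (1 / zeta) <= 1 / m]. *)
Lemma kernel_le (k d eta m s rho : R) : 0 < eta -> 0 < k ->
  (s + d) * m <= zeta_sq d eta s rho -> 0 < m ->
  Rabs (kernel_re k d eta s rho) <= exp (k / m) /\
  Rabs (kernel_im k d eta s rho) <= exp (k / m).
Proof.
  intros He Hk Hm Hm0; assert (Hz := zeta_sq_pos d eta s rho He).
  assert (Hexp : exp (k * ((s + d) * / zeta_sq d eta s rho)) <= exp (k / m)).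
  { assert (Hq : (s + d) * / zeta_sq d eta s rho <= / m).
    { apply Rmult_le_reg_r with (zeta_sq d eta s rho * m).
      - now apply Rmult_lt_0_compat.
      - replace ((s + d) * / zeta_sq d eta s rho * (zeta_sq d eta s rho * m))
          with ((s + d) * m) by (field; lra).
        replace (/ m * (zeta_sq d eta s rho * m)) with (zeta_sq d eta s rho)
          by (field; lra).
        exact Hm. }
    assert (k * ((s + d) * / zeta_sq d eta s rho) <= k / m).
    { apply Rmult_le_compat_l; lra. }
    destruct H as [H | H]; [ left; now apply exp_increasing | rewrite H; lra ]. }
  unfold kernel_re, kernel_im; rewrite !Rabs_mult.
  rewrite (Rabs_right (exp _)) by (left; apply exp_pos).
  assert (Hp := exp_pos (k * ((s + d) * / zeta_sq d eta s rho))).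
  split; (apply Rle_trans with (2 := Hexp); rewrite <- Rmult_1_r;
    apply Rmult_le_compat_l; [ lra | ]).
  - apply Rabs_le; generalize (COS_bound
     (k * (- (rho * rho + eta) * / zeta_sq d eta s rho))); lra.
  - apply Rabs_le; generalize (SIN_bound
     (k * (- (rho * rho + eta) * / zeta_sq d eta s rho))); lra.
Qed.

Lemma cos_ge_half (x : R) : Rabs x <= 1 -> / 2 <= cos x.
Proof.
  intros Hx.
  replace (/ 2) with (cos (PI / 3)) by (rewrite cos_PI3; lra).
  generalize PI2_3_2 PI_4; intros Hpi Hpi4.
  destruct (Rle_dec 0 x) as [H0 | H0].
  - rewrite Rabs_right in Hx by lra; apply cos_decr_1; lra.
  - rewrite Rabs_left in Hx by lra; rewrite <- (cos_neg x); apply cos_decr_1; lra.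
Qed.

(** For [s >= 0] one has [|zeta| >= d], so the phase [k eta / |zeta|^2] is at most 1 and the real
    part is at least half the modulus. *)
Lemma kernel_re_axis_ge (k d eta s : R) : 0 < eta -> 0 < k -> 0 < d -> 0 <= s ->
  k * eta <= d * d ->
  / 2 * exp (k * ((s + d) * / zeta_sq d eta s 0)) <= kernel_re k d eta s 0.
Proof.
  intros He Hk Hd Hs Hke; assert (Hz := zeta_sq_pos d eta s 0 He).
  unfold kernel_re; rewrite Rmult_comm.
  apply Rmult_le_compat_l; [ left; apply exp_pos | ].
  apply cos_ge_half.
  rewrite !Rabs_mult, Rabs_inv, Rabs_Ropp, (Rabs_right k), (Rabs_right (zeta_sq _ _ _ _)),
    (Rabs_right (_ + eta)) by nra.
  apply Rmult_le_reg_r with (zeta_sq d eta s 0); [ lra | ].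
  field_simplify; [ | lra ].
  unfold zeta_sq; nra.
Qed.

(** * Boundary values of holomorphic functions *)

(* [Y1 + i Y2] is holomorphic as a function of [s + i rho^2]. *)
Definition folded_CR (e : R) (Y1 Y2 Y1s Y2s : R -> R -> R) : Prop :=
  forall s rho, Rabs s < e -> Rabs rho < e ->
    is_derive (fun r => Y1 r rho) s (Y1s s rho) /\
    is_derive (fun r => Y2 r rho) s (Y2s s rho) /\
    is_derive (Y1 s) rho (- (2 * rho) * Y2s s rho) /\
    is_derive (Y2 s) rho (2 * rho * Y1s s rho) /\
    continuous (fun p : R * R => Y1 (fst p) (snd p)) (s, rho) /\
    continuous (fun p : R * R => Y2 (fst p) (snd p)) (s, rho) /\
    continuous (fun p : R * R => Y1s (fst p) (snd p)) (s, rho) /\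
    continuous (fun p : R * R => Y2s (fst p) (snd p)) (s, rho).

Lemma is_derive_Rmult (f g : R -> R) (x df dg : R) :
  is_derive f x df -> is_derive g x dg ->
  is_derive (fun y => f y * g y) x (df * g x + f x * dg).
Proof.
  intros Hf Hg; apply (is_derive_mult f g x df dg Hf Hg).
  intros; apply Rmult_comm.
Qed.

Lemma is_derive_Rplus (f g : R -> R) (x df dg : R) :
  is_derive f x df -> is_derive g x dg ->
  is_derive (fun y => f y + g y) x (df + dg).
Proof. exact (is_derive_plus (V := R_NormedModule) f g x df dg). Qed.

Lemma is_derive_Rminus (f g : R -> R) (x df dg : R) :
  is_derive f x df -> is_derive g x dg ->
  is_derive (fun y => f y - g y) x (df - dg).
Proof. exact (is_derive_minus (V := R_NormedModule) f g x df dg). Qed.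

Lemma is_derive_eq (f : R -> R) (x l l' : R) :
  is_derive f x l -> l = l' -> is_derive f x l'.
Proof. now intros H <-. Qed.

(* Since [Y H] satisfies the same equation as [Y], the [s]-derivative of the
   integral of [2 rho Re (Y H)] is an exact integral in [rho]. *)
Lemma folded_CR_flux (e : R) (Y1 Y2 Y1s Y2s H1 H2 H1s H2s : R -> R -> R) (r s : R) :
  folded_CR e Y1 Y2 Y1s Y2s -> folded_CR e H1 H2 H1s H2s ->
  0 < r < e -> Rabs s < e ->
  is_derive (fun s => RInt (fun rho => 2 * rho * (Y1 s rho * H1 s rho - Y2 s rho * H2 s rho)) 0 r)
    s (Y1 s r * H2 s r + Y2 s r * H1 s r - (Y1 s 0 * H2 s 0 + Y2 s 0 * H1 s 0)).
Proof.
  intros HY HH Hr Hs.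
  (* The margin [e - r] around [[0, r]] reaches negative radii, which [folded_CR] covers. *)
  assert (Hrho : forall rho, 0 - (e - r) < rho < r + (e - r) -> Rabs rho < e).
  { intros rho H; apply Rabs_def1; lra. }
  set (dP := fun s rho => 2 * rho *
         ((Y1s s rho * H1 s rho + Y1 s rho * H1s s rho)
          - (Y2s s rho * H2 s rho + Y2 s rho * H2s s rho))).
  assert (HdP : forall rho, Rabs rho < e ->
    continuous (fun p : R * R => dP (fst p) (snd p)) (s, rho)).
  { intros rho Hq; unfold dP.
    destruct (HY s rho Hs Hq) as (_ & _ & _ & _ & ? & ? & ? & ?).
    destruct (HH s rho Hs Hq) as (_ & _ & _ & _ & ? & ? & ? & ?).
    prove_continuous. }
  replace (Y1 s r * H2 s r + _ - _) with (RInt (dP s) 0 r).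
  - apply (is_derive_RInt_param_margin _ dP 0 r (e - r) s); try lra.
    + apply filter_imp with (2 := locally_Rabs_lt s e Hs); intros y Hy t Ht.
      destruct (HY y t Hy (Hrho t Ht)) as (DY1 & DY2 & _).
      destruct (HH y t Hy (Hrho t Ht)) as (DH1 & DH2 & _).
      eapply is_derive_eq.
      * apply (is_derive_scal (fun u => Y1 u t * H1 u t - Y2 u t * H2 u t)).
        apply is_derive_Rminus; apply is_derive_Rmult; eassumption.
      * reflexivity.
    + intros t Ht; apply HdP, Hrho; lra.
    + apply filter_imp with (2 := locally_Rabs_lt s e Hs); intros y Hy t Ht.
      assert (Ht' : Rabs t < e) by (apply Hrho; lra).
      destruct (HY y t Hy Ht') as (_ & _ & _ & _ & C1 & C2 & _).
      destruct (HH y t Hy Ht') as (_ & _ & _ & _ & C3 & C4 & _).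
      apply continuous_section in C1, C2, C3, C4.
      apply continuous_Rmult; [ prove_continuous | ].
      apply continuous_Rminus; now apply continuous_Rmult.
  - apply is_RInt_unique.
    (* The antiderivative is [Im (Y H)], whose [rho]-derivative is [2 rho] times the [s]-derivative
       of [Re (Y H)]. *)
    apply (is_RInt_derive (V := R_CompleteNormedModule)
      (fun rho => Y1 s rho * H2 s rho + Y2 s rho * H1 s rho) (dP s) 0 r);
      rewrite Rmin_left, Rmax_right by lra; intros t Ht;
      assert (Ht' : Rabs t < e) by (apply Hrho; lra).
    + destruct (HY s t Hs Ht') as (_ & _ & DY1 & DY2 & _).
      destruct (HH s t Hs Ht') as (_ & _ & DH1 & DH2 & _).
      eapply is_derive_eq.
      * apply is_derive_Rplus; apply is_derive_Rmult; eassumption.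
      * unfold dP; ring.
    + apply (continuous_section dP), HdP, Ht'.
Qed.

Lemma folded_CR_kernel (e k d eta : R) : 0 < eta ->
  folded_CR e (kernel_re k d eta) (kernel_im k d eta)
    (kernel_re_ds k d eta) (kernel_im_ds k d eta).
Proof.
  intros He s rho _ _.
  destruct (kernel_derivatives k d eta s rho He) as (? & ? & ? & ?).
  destruct (kernel_continuous k d eta s rho He) as (? & ? & ? & ?).
  now repeat (split; [ assumption | ]).
Qed.

Lemma Rabs_mult_plus_le (a b c d B E : R) : 0 <= B ->
  Rabs a <= B -> Rabs b <= B -> Rabs c <= E -> Rabs d <= E ->
  Rabs (a * c + b * d) <= 2 * B * E.
Proof.
  intros HB Ha Hb Hc Hd.
  apply Rle_trans with (1 := Rabs_triang _ _); rewrite !Rabs_mult.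
  assert (Rabs a * Rabs c <= B * E)
    by (apply Rmult_le_compat; auto using Rabs_pos).
  assert (Rabs b * Rabs d <= B * E)
    by (apply Rmult_le_compat; auto using Rabs_pos).
  lra.
Qed.

Lemma MVT_lower_bound (P dP : R -> R) (a b m : R) : a < b ->
  (forall x, a <= x <= b -> is_derive P x (dP x)) ->
  (forall x, a <= x <= b -> m <= dP x) ->
  (b - a) * m <= P b - P a.
Proof.
  intros Hab Hd Hm.
  destruct (MVT_gen P a b dP) as [c [Hc Heq]].
  - rewrite Rmin_left, Rmax_right by lra; intros x Hx; apply Hd; lra.
  - rewrite Rmin_left, Rmax_right by lra; intros x Hx.
    apply continuity_pt_filterlim, (ex_derive_continuous (V := R_NormedModule)).
    eexists; now apply Hd.
  - rewrite Rmin_left, Rmax_right in Hc by lra.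
    rewrite Heq, Rmult_comm; apply Rmult_le_compat_r; [ lra | now apply Hm ].
Qed.

(* Exponentials [exp (k / zeta)] with the pole of [1 / zeta] just outside the
   domain, to the left of the support of [F]: as [k] grows, their size near the
   support of [F] beats exponentially their size on the rest of the boundary. *)
Lemma folded_CR_no_flat_boundary_value (e : R) (Y1 Y2 Y1s Y2s : R -> R -> R) (F : R -> R) :
  0 < e -> folded_CR e Y1 Y2 Y1s Y2s ->
  (forall s, Rabs s < e -> Y1 s 0 = 0 /\ Y2 s 0 = - F s) ->
  (forall s, s <= 0 -> F s = 0) -> (forall s, 0 < s -> 0 < F s) ->
  (forall s s', s <= s' -> F s <= F s') ->
  False.
Proof.
  intros He HY HY0 Fneg Fpos Fmono.
  (* With [a = r^2], the region [|s| <= a], [0 <= rho <= r] is the rectangle [[-a, a] x [0, a]] in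
     the variable [s + i rho^2]. The bound [r < 1] gives [a < r], and later [eta <= a / 8]. *)
  set (r := Rmin e 1 / 2).
  assert (Hr : 0 < r < e /\ r < 1).
  { assert (Hm := Rmin_pos e 1 He Rlt_0_1).
    assert (H1 := Rmin_l e 1); assert (H2 := Rmin_r e 1); unfold r; lra. }
  set (a := r * r).
  assert (Ha : 0 < a < r) by (unfold a; nra).
  assert (Has : forall s, - a <= s <= a -> Rabs s < e)
    by (intros s Hs; apply Rabs_def1; lra).
  assert (Hrs : forall rho, 0 <= rho <= r -> Rabs rho < e)
    by (intros rho Hs; apply Rabs_def1; lra).
  assert (Hbound : exists B, 0 <= B /\
    (forall s, - a <= s <= a -> Rabs (Y1 s r) <= B /\ Rabs (Y2 s r) <= B) /\
    (forall rho, 0 <= rho <= r -> Rabs (Y1 a rho) <= B /\ Rabs (Y2 a rho) <= B) /\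
    (forall rho, 0 <= rho <= r -> Rabs (Y1 (- a) rho) <= B /\ Rabs (Y2 (- a) rho) <= B)).
  { assert (Hc : forall s rho, - a <= s <= a -> 0 <= rho <= r ->
       continuous (fun p : R * R => Y1 (fst p) (snd p)) (s, rho) /\
       continuous (fun p : R * R => Y2 (fst p) (snd p)) (s, rho)).
    { intros s rho Hs Hrho.
      destruct (HY s rho (Has s Hs) (Hrs rho Hrho)) as (_ & _ & _ & _ & ? & ? & _).
      now split. }
    destruct (continuous_bounded (fun s => Y1 s r) (- a) a) as (B1 & ? & HB1); [ lra | | ].
    { intros; apply continuous_section_l, Hc; lra. }
    destruct (continuous_bounded (fun s => Y2 s r) (- a) a) as (B2 & ? & HB2); [ lra | | ].
    { intros; apply continuous_section_l, Hc; lra. }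
    destruct (continuous_bounded (Y1 a) 0 r) as (B3 & ? & HB3); [ lra | | ].
    { intros; apply continuous_section, Hc; lra. }
    destruct (continuous_bounded (Y2 a) 0 r) as (B4 & ? & HB4); [ lra | | ].
    { intros; apply continuous_section, Hc; lra. }
    destruct (continuous_bounded (Y1 (- a)) 0 r) as (B5 & ? & HB5); [ lra | | ].
    { intros; apply continuous_section, Hc; lra. }
    destruct (continuous_bounded (Y2 (- a)) 0 r) as (B6 & ? & HB6); [ lra | | ].
    { intros; apply continuous_section, Hc; lra. }
    exists (B1 + B2 + B3 + B4 + B5 + B6); split; [ lra | ].
    repeat split;
      (eapply Rle_trans;
        [ first [ now apply HB1 | now apply HB2 | now apply HB3
                | now apply HB4 | now apply HB5 | now apply HB6 ] | lra ]). }
  destruct Hbound as (B & HB & Btop & Bright & Bleft).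
  set (F0 := F (a / 16)).
  assert (HF0 : 0 < F0) by (apply Fpos; lra).
  (* The contradiction comes from [c0 * G <= C0 * E]. In [c0], [a / 32] is the width [a / 16] of the
     window [[a / 16, a / 8]] times the 1/2 of [kernel_re_axis_ge]. In [C0], [12 a] is [4 a] for
     each vertical side plus [4 a] for the top, where the loss [2 * B * E] acts over length
     [2 a]. *)
  set (c0 := a / 32 * F0).
  assert (Hc0 : 0 < c0) by (unfold c0; nra).
  set (C0 := 12 * a * B).
  assert (HC0 : 0 <= C0) by (unfold C0; nra).
  assert (HCc : 0 <= C0 / c0) by (apply Rdiv_le_0_compat; lra).
  (* Chosen so that [2 k / (3 a)], the exponential gain of the window over the other sides, exceeds
     [C0 / c0]. *)
  set (k := 1 + 3 * a / 2 * (C0 / c0)).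
  assert (Hk : 1 <= k) by (unfold k; nra).
  set (d := a / 4).
  (* The largest shift that [kernel_re_axis_ge] allows. The pole sits at [s = - a / 4], just below
     the axis. *)
  set (eta := d * d / k).
  assert (Hke : k * eta = d * d) by (unfold eta; field; lra).
  assert (Heta : 0 < eta).
  { apply Rdiv_lt_0_compat; [ unfold d; nra | lra ]. }
  assert (Heta8 : eta <= a / 8).
  { apply Rle_trans with (d * d); [ nra | unfold d; nra ]. }
  (* In the variable [s + i rho^2], the disc of [kernel_le] has a horizontal diameter over
     [[- a / 4, a / 2]], at height [- eta]. Its radius [3 a / 8] keeps it away from the top and both
     vertical sides. *)
  set (m := 3 * a / 4).
  assert (Hm : 0 < m) by (unfold m; lra).
  set (E := exp (k / m)).
  assert (HE : 0 < E) by apply exp_pos.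
  set (H1 := kernel_re k d eta); set (H2 := kernel_im k d eta).
  assert (Hker : forall s rho, (s + d) * m <= zeta_sq d eta s rho ->
     Rabs (H1 s rho) <= E /\ Rabs (H2 s rho) <= E).
  { intros; apply kernel_le; lra. }
  assert (Htop : forall s, Rabs (H1 s r) <= E /\ Rabs (H2 s r) <= E).
  { intros s; apply Hker; unfold zeta_sq; fold a; unfold m.
    assert (a * a <= (a + eta) * (a + eta)) by nra.
    set (c := s + d); assert (0 <= (c - 3 * a / 8) * (c - 3 * a / 8)) by apply Rle_0_sqr.
    nra. }
  assert (Hright : forall rho, Rabs (H1 a rho) <= E /\ Rabs (H2 a rho) <= E).
  { intros rho; apply Hker; unfold zeta_sq, m, d.
    assert (0 <= (rho * rho + eta) * (rho * rho + eta)) by apply Rle_0_sqr.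
    nra. }
  assert (Hleft : forall rho, Rabs (H1 (- a) rho) <= E /\ Rabs (H2 (- a) rho) <= E).
  { intros rho; apply Hker; unfold zeta_sq, m, d.
    assert (0 <= (rho * rho + eta) * (rho * rho + eta)) by apply Rle_0_sqr.
    nra. }
  set (P := fun s => RInt (fun rho => 2 * rho * (Y1 s rho * H1 s rho - Y2 s rho * H2 s rho)) 0 r).
  set (dP := fun s => Y1 s r * H2 s r + Y2 s r * H1 s r
                      - (Y1 s 0 * H2 s 0 + Y2 s 0 * H1 s 0)).
  assert (HP : forall s, - a <= s <= a -> is_derive P s (dP s)).
  { intros s Hs; unfold P, dP.
    apply (folded_CR_flux e Y1 Y2 Y1s Y2s H1 H2
             (kernel_re_ds k d eta) (kernel_im_ds k d eta)); auto; try lra.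
    now apply folded_CR_kernel. }
  assert (Haxis : forall s, 0 <= s ->
     / 2 * exp (k * ((s + d) * / zeta_sq d eta s 0)) <= H1 s 0).
  { intros s Hs; apply kernel_re_axis_ge; try lra; unfold d; lra. }
  assert (HdP : forall s, - a <= s <= a -> - (2 * B * E) + F s * H1 s 0 <= dP s).
  { intros s Hs; unfold dP.
    destruct (HY0 s (Has s Hs)) as [-> ->].
    destruct (Btop s Hs); destruct (Htop s).
    assert (Htop_s : Rabs (Y1 s r * H2 s r + Y2 s r * H1 s r) <= 2 * B * E)
      by (now apply Rabs_mult_plus_le).
    apply Rabs_le_between in Htop_s; lra. }
  assert (HdP' : forall s, - a <= s <= a -> - (2 * B * E) <= dP s).
  { intros s Hs; apply Rle_trans with (2 := HdP s Hs).
    enough (0 <= F s * H1 s 0) by lra.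
    (* For [s <= 0] no bound on the kernel is available or sought, as the pole is near: the factor
       [F s] is exactly zero. *)
    destruct (Rle_dec s 0) as [Hs0 | Hs0].
    - rewrite Fneg by assumption; lra.
    - apply Rmult_le_pos; [ left; apply Fpos; lra | ].
      apply Rle_trans with (2 := Haxis s ltac:(lra)).
      apply Rmult_le_pos; [ lra | left; apply exp_pos ]. }
  (* On the window, [s + d] lies in [[5 a / 16, 3 a / 8]] and [eta <= a / 8], so [zeta] is in the
     disc with diameter [[0, a / 2]], where [Re (1 / zeta) >= 2 / a]. *)
  set (G := exp (2 * k / a)).
  assert (HdPmid : forall s, a / 16 <= s <= a / 8 ->
     F0 * (/ 2 * G) - 2 * B * E <= dP s).
  { intros s Hs; apply Rle_trans with (2 := HdP s ltac:(lra)).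
    enough (F0 * (/ 2 * G) <= F s * H1 s 0) by lra.
    assert (HG : 0 < G) by apply exp_pos.
    apply Rmult_le_compat; [ lra | lra | apply Fmono; lra | ].
    apply Rle_trans with (2 := Haxis s ltac:(lra)).
    apply Rmult_le_compat_l; [ lra | ].
    assert (Hz := zeta_sq_pos d eta s 0 Heta).
    assert (Hq : 2 * k / a <= k * ((s + d) * / zeta_sq d eta s 0)).
    { replace (2 * k / a) with (k * (2 * / a)) by (field; lra).
      apply Rmult_le_compat_l; [ lra | ].
      apply Rmult_le_reg_r with (zeta_sq d eta s 0 * a).
      - apply Rmult_lt_0_compat; lra.
      - replace ((s + d) * / zeta_sq d eta s 0 * (zeta_sq d eta s 0 * a))
          with ((s + d) * a) by (field; lra).
        replace (2 * / a * (zeta_sq d eta s 0 * a)) with (2 * zeta_sq d eta s 0)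
          by (field; lra).
        unfold zeta_sq, d.
        assert (eta * eta <= a / 8 * (a / 8)) by (apply Rmult_le_compat; lra).
        nra. }
    destruct Hq as [Hq | Hq]; [ left; now apply exp_increasing | unfold G; rewrite Hq; lra ]. }
  (* The three mean value bounds add up to a lower bound of [P a - P (- a)], the contribution of the
     vertical sides; only the middle one carries the gain [G]. *)
  assert (M1 := MVT_lower_bound P dP (- a) (a / 16) (- (2 * B * E)) ltac:(lra)
    (fun s Hs => HP s ltac:(lra)) (fun s Hs => HdP' s ltac:(lra))).
  assert (M2 := MVT_lower_bound P dP (a / 16) (a / 8) _ ltac:(lra)
    (fun s Hs => HP s ltac:(lra)) HdPmid).
  assert (M3 := MVT_lower_bound P dP (a / 8) a (- (2 * B * E)) ltac:(lra)
    (fun s Hs => HP s ltac:(lra)) (fun s Hs => HdP' s ltac:(lra))).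
  assert (HPend : forall s, (s = a \/ s = - a) -> Rabs (P s) <= 4 * a * B * E).
  { intros s Hs.
    assert (Hs' : - a <= s <= a) by (destruct Hs; lra).
    replace (4 * a * B * E) with ((r - 0) * (2 * r * (2 * B * E))) by (unfold a; ring).
    apply abs_RInt_le_const; [ lra | | ].
    - apply (ex_RInt_continuous (V := R_CompleteNormedModule)).
      rewrite Rmin_left, Rmax_right by lra; intros t Ht.
      destruct (HY s t (Has s Hs') (Hrs t Ht)) as (_ & _ & _ & _ & C1 & C2 & _).
      destruct (kernel_continuous k d eta s t Heta) as (C3 & C4 & _).
      apply continuous_section in C1, C2, C3, C4.
      apply continuous_Rmult; [ prove_continuous | ].
      apply continuous_Rminus; now apply continuous_Rmult.
    - intros t Ht; rewrite Rabs_mult, (Rabs_right (2 * t)) by lra.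
      apply Rmult_le_compat; [ lra | apply Rabs_pos | lra | ].
      replace (Y1 s t * H1 s t - Y2 s t * H2 s t)
        with (Y1 s t * H1 s t + Y2 s t * (- H2 s t)) by ring.
      apply Rabs_mult_plus_le; rewrite ?Rabs_Ropp; auto.
      all: destruct Hs as [-> | ->]; now first
        [ apply Bright | apply Bleft | apply Hright | apply Hleft ]. }
  assert (HPa := HPend a (or_introl eq_refl)).
  assert (HPb := HPend (- a) (or_intror eq_refl)).
  apply Rabs_le_between in HPa, HPb.
  assert (Hfinal : c0 * G <= C0 * E) by (unfold c0, C0; nra).
  assert (HG : G = E * exp (2 * k / (3 * a))).
  (* The gain in the exponent is [2 / a - 1 / m = 2 / (3 a)] per unit of [k]. *)
  { unfold G, E; rewrite <- exp_plus; f_equal; unfold m; field; lra. }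
  assert (Hx : 1 + C0 / c0 <= exp (2 * k / (3 * a))).
  { apply Rle_trans with (1 + 2 * k / (3 * a)).
    - apply Rplus_le_compat_l.
      replace (2 * k / (3 * a)) with (C0 / c0 + 2 / (3 * a)) by (unfold k; field; lra).
      assert (0 < 2 / (3 * a)) by (apply Rdiv_lt_0_compat; lra).
      lra.
    - left; apply exp_ineq1.
      apply Rgt_not_eq, Rdiv_lt_0_compat; lra. }
  rewrite HG in Hfinal.
  assert (H : c0 * (1 + C0 / c0) = c0 + C0) by (field; lra).
  assert (Hy : c0 * (1 + C0 / c0) <= c0 * exp (2 * k / (3 * a)))
    by (apply Rmult_le_compat_l; lra).
  assert (c0 * exp (2 * k / (3 * a)) <= C0).
  { apply Rmult_le_reg_r with E; [ exact HE | ].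
    replace (c0 * exp (2 * k / (3 * a)) * E)
      with (c0 * (E * exp (2 * k / (3 * a)))) by ring.
    exact Hfinal. }
  lra.
Qed.

(** * The Lewy equation in polar coordinates *)

Definition C1_cube (e : R) (f fx fy fs : R -> R -> R -> R) : Prop :=
  forall x y s, Rabs x < e -> Rabs y < e -> Rabs s < e ->
    is_derive (fun u => f u y s) x (fx x y s) /\
    is_derive (fun u => f x u s) y (fy x y s) /\
    is_derive (fun u => f x y u) s (fs x y s) /\
    continuous (fun p : R * R * R => fx (fst (fst p)) (snd (fst p)) (snd p)) (x, y, s) /\
    continuous (fun p : R * R * R => fy (fst (fst p)) (snd (fst p)) (snd p)) (x, y, s) /\
    continuous (fun p : R * R * R => fs (fst (fst p)) (snd (fst p)) (snd p)) (x, y, s).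

(** Total differentiability at a point needs one partial derivative near it, continuous at it, and
    the other at the point alone; the chain rule then applies. *)
Lemma is_derive_comp2 (f fx : R -> R -> R) (X Y : R -> R) (t dX dY fy : R) :
  locally (X t, Y t) (fun u : R * R =>
    is_derive (fun z => f z (snd u)) (fst u) (fx (fst u) (snd u))) ->
  is_derive (f (X t)) (Y t) fy ->
  continuous (fun u : R * R => fx (fst u) (snd u)) (X t, Y t) ->
  is_derive X t dX -> is_derive Y t dY ->
  is_derive (fun u => f (X u) (Y u)) t (dX * fx (X t) (Y t) + dY * fy).
Proof.
  intros Hfx Hfy Hc HX HY.
  apply filterdiff_ext_lin with
    (fun h : R => plus (scal (scal h dX) (fx (X t) (Y t))) (scal (scal h dY) fy)).
  - apply (filterdiff_comp'_2 X Y f t (fun h => scal h dX) (fun h => scal h dY)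
      (fun a b => plus (scal a (fx (X t) (Y t))) (scal b fy)) HX HY).
    now apply is_derive_filterdiff.
  - intros h.
    change (h * dX * fx (X t) (Y t) + h * dY * fy
            = h * (dX * fx (X t) (Y t) + dY * fy)); ring.
Qed.

Lemma continuous_of_partials (f fx : R -> R -> R) (x y fy : R) :
  locally (x, y) (fun u : R * R =>
    is_derive (fun z => f z (snd u)) (fst u) (fx (fst u) (snd u))) ->
  is_derive (f x) y fy ->
  continuous (fun u : R * R => fx (fst u) (snd u)) (x, y) ->
  continuous (fun u : R * R => f (fst u) (snd u)) (x, y).
Proof.
  intros Hx Hy Hc.
  apply (filterdiff_continuous (K := R_AbsRing) (V := R_NormedModule)
    (fun u : R * R => f (fst u) (snd u)) (x, y)).
  eexists; now apply is_derive_filterdiff with (1 := Hx) (2 := Hy).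
Qed.

Lemma locally_pair_Rabs_lt (x y e : R) : Rabs x < e -> Rabs y < e ->
  locally (x, y) (fun p : R * R => Rabs (fst p) < e /\ Rabs (snd p) < e).
Proof.
  intros Hx Hy.
  destruct (locally_Rabs_lt x e Hx) as [d1 H1], (locally_Rabs_lt y e Hy) as [d2 H2].
  exists (mkposreal _ (Rmin_pos d1 d2 (cond_pos d1) (cond_pos d2))).
  intros [u v] [Hu Hv]; split; [ apply H1 | apply H2 ].
  - apply ball_le with (2 := Hu), Rmin_l.
  - apply ball_le with (2 := Hv), Rmin_r.
Qed.

Lemma C1_cube_opp (e : R) (f fx fy fs : R -> R -> R -> R) :
  C1_cube e f fx fy fs ->
  C1_cube e (fun x y s => - f x y s) (fun x y s => - fx x y s)
    (fun x y s => - fy x y s) (fun x y s => - fs x y s).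
Proof.
  intros H x y s Hx Hy Hs.
  destruct (H x y s Hx Hy Hs) as (D1 & D2 & D3 & C1 & C2 & C3).
  split; [ | split; [ | split; [ | split; [ | split ] ] ] ].
  - exact (is_derive_opp (V := R_NormedModule) (fun u => f u y s) x _ D1).
  - exact (is_derive_opp (V := R_NormedModule) (fun u => f x u s) y _ D2).
  - exact (is_derive_opp (V := R_NormedModule) (fun u => f x y u) s _ D3).
  - now apply continuous_Ropp.
  - now apply continuous_Ropp.
  - now apply continuous_Ropp.
Qed.

(* Real part of [e^(i t) (p + i q)] at the point [z = rho e^(i t)]; the
   imaginary part is [polar q (- p)]. *)
Definition polar (p q : R -> R -> R -> R) (s rho t : R) : R :=
  p (rho * cos t) (rho * sin t) s * cos t - q (rho * cos t) (rho * sin t) s * sin t.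

Lemma polar_in_cube (rho t e : R) : Rabs rho < e ->
  Rabs (rho * cos t) < e /\ Rabs (rho * sin t) < e.
Proof.
  intros H.
  assert (Hc : Rabs (cos t) <= 1) by (apply Rabs_le, COS_bound).
  assert (Hs : Rabs (sin t) <= 1) by (apply Rabs_le, SIN_bound).
  rewrite !Rabs_mult; assert (Hp := Rabs_pos rho).
  split; nra.
Qed.

Lemma polar_continuous (p q : R -> R -> R -> R) (s rho t : R) :
  (forall x y, x = rho * cos t -> y = rho * sin t ->
    continuous (fun p' : R * R * R => p (fst (fst p')) (snd (fst p')) (snd p')) (x, y, s) /\
    continuous (fun p' : R * R * R => q (fst (fst p')) (snd (fst p')) (snd p')) (x, y, s)) ->
  continuous (fun w : R * R * R => polar p q (fst (fst w)) (snd (fst w)) (snd w)) (s, rho, t).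
Proof.
  intros H; destruct (H _ _ eq_refl eq_refl) as [Hp Hq].
  assert (Cs : continuous (fun w : R * R * R => fst (fst w)) (s, rho, t)).
  { apply (continuous_comp fst fst); apply continuous_fst. }
  assert (Cr : continuous (fun w : R * R * R => snd (fst w)) (s, rho, t)).
  { apply (continuous_comp fst snd); [ apply continuous_fst | apply continuous_snd ]. }
  assert (Ct : continuous (fun w : R * R * R => snd w) (s, rho, t)) by apply continuous_snd.
  assert (Hcomp : forall g : R -> R -> R -> R,
    continuous (fun p' : R * R * R => g (fst (fst p')) (snd (fst p')) (snd p'))
      (rho * cos t, rho * sin t, s) ->
    continuous (fun w : R * R * R =>
      g (snd (fst w) * cos (snd w)) (snd (fst w) * sin (snd w)) (fst (fst w))) (s, rho, t)).
  { intros g Hg.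
    apply (continuous_comp
      (fun w : R * R * R => (snd (fst w) * cos (snd w), snd (fst w) * sin (snd w), fst (fst w)))
      (fun p' : R * R * R => g (fst (fst p')) (snd (fst p')) (snd p'))); [ | exact Hg ].
    apply continuous_pair; [ apply continuous_pair | exact Cs ].
    - apply continuous_Rmult; [ exact Cr | ].
      apply (continuous_derivable_comp cos); [ exact ex_derive_cos | exact Ct ].
    - apply continuous_Rmult; [ exact Cr | ].
      apply (continuous_derivable_comp sin); [ exact ex_derive_sin | exact Ct ]. }
  unfold polar.
  apply continuous_Rminus; apply continuous_Rmult.
  - now apply (Hcomp p).
  - apply (continuous_derivable_comp cos); [ exact ex_derive_cos | exact Ct ].
  - now apply (Hcomp q).
  - apply (continuous_derivable_comp sin); [ exact ex_derive_sin | exact Ct ].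
Qed.

Lemma C1_cube_chain (e : R) (f fx fy fs : R -> R -> R -> R) (X Y : R -> R) (s t dX dY : R) :
  C1_cube e f fx fy fs -> Rabs s < e -> Rabs (X t) < e -> Rabs (Y t) < e ->
  is_derive X t dX -> is_derive Y t dY ->
  is_derive (fun u => f (X u) (Y u) s) t
    (dX * fx (X t) (Y t) s + dY * fy (X t) (Y t) s).
Proof.
  intros H Hs HXt HYt HX HY.
  apply (is_derive_comp2 (fun x y => f x y s) (fun x y => fx x y s)); trivial.
  - apply filter_imp with (2 := locally_pair_Rabs_lt _ _ _ HXt HYt).
    intros [x y] [Hx Hy]; now apply (H x y s).
  - now apply (H (X t) (Y t) s).
  - apply (continuous_section_l (fun (w : R * R) s => fx (fst w) (snd w) s)).
    now apply (H (X t) (Y t) s).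
Qed.


(** All three differentiate [Re (e^(i t) u)] with [u = p + i q]. In the angular one, the last term
    is [Re (i e^(i t) u) = - Im (e^(i t) u)], from the factor [e^(i t)]. *)
Lemma polar_derivatives (e : R) (p px py ps q qx qy qs : R -> R -> R -> R) (s rho t : R) :
  C1_cube e p px py ps -> C1_cube e q qx qy qs -> Rabs s < e -> Rabs rho < e ->
  is_derive (fun y => polar p q y rho t) s (polar ps qs s rho t) /\
  is_derive (fun r => polar p q s r t) rho
    (polar px qx s rho t * cos t + polar py qy s rho t * sin t) /\
  is_derive (polar p q s rho) t
    (rho * (polar py qy s rho t * cos t - polar px qx s rho t * sin t)
     - polar q (fun x y s => - p x y s) s rho t).
Proof.
  intros Hp Hq Hs Hr.
  destruct (polar_in_cube rho t e Hr) as [Hx Hy].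
  assert (Dcos : is_derive cos t (- sin t)) by (auto_derive; trivial; ring).
  assert (Dsin : is_derive sin t (cos t)) by (auto_derive; trivial; ring).
  assert (DX : is_derive (fun r => r * cos t) rho (cos t)) by (auto_derive; trivial; ring).
  assert (DY : is_derive (fun r => r * sin t) rho (sin t)) by (auto_derive; trivial; ring).
  assert (DXt : is_derive (fun u => rho * cos u) t (- (rho * sin t)))
    by (auto_derive; trivial; ring).
  assert (DYt : is_derive (fun u => rho * sin u) t (rho * cos t))
    by (auto_derive; trivial; ring).
  split; [ | split ]; unfold polar.
  - destruct (Hp _ _ s Hx Hy Hs) as (_ & _ & D1 & _).
    destruct (Hq _ _ s Hx Hy Hs) as (_ & _ & D2 & _).
    eapply is_derive_eq.
    + apply is_derive_Rminus; apply is_derive_Rmult;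
        [ exact D1 | apply is_derive_const | exact D2 | apply is_derive_const ].
    + unfold zero; simpl; ring.
  - assert (D1 := C1_cube_chain e p px py ps _ _ s rho _ _ Hp Hs Hx Hy DX DY).
    assert (D2 := C1_cube_chain e q qx qy qs _ _ s rho _ _ Hq Hs Hx Hy DX DY).
    eapply is_derive_eq.
    + apply is_derive_Rminus; apply is_derive_Rmult;
        [ exact D1 | apply is_derive_const | exact D2 | apply is_derive_const ].
    + unfold zero; simpl; ring.
  - assert (D1 := C1_cube_chain e p px py ps _ _ s t _ _ Hp Hs Hx Hy DXt DYt).
    assert (D2 := C1_cube_chain e q qx qy qs _ _ s t _ _ Hq Hs Hx Hy DXt DYt).
    eapply is_derive_eq.
    + apply is_derive_Rminus; apply is_derive_Rmult;
        [ exact D1 | exact Dcos | exact D2 | exact Dsin ].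
    + simpl; ring.
Qed.

Definition circle_int (p q : R -> R -> R -> R) (s rho : R) : R :=
  RInt (polar p q s rho) 0 (2 * PI).

Lemma two_PI_pos : 0 < 2 * PI.
Proof. generalize PI_RGT_0; lra. Qed.

Lemma is_derive_circle_int_s (e : R) (p px py ps q qx qy qs : R -> R -> R -> R) (s rho : R) :
  C1_cube e p px py ps -> C1_cube e q qx qy qs -> Rabs s < e -> Rabs rho < e ->
  is_derive (fun y => circle_int p q y rho) s (circle_int ps qs s rho).
Proof.
  intros Hp Hq Hs Hr; generalize two_PI_pos; intros HPI.
  apply (is_derive_RInt_param_margin (fun y => polar p q y rho)
           (fun y => polar ps qs y rho) 0 (2 * PI) 1 s); try lra.
  - apply filter_imp with (2 := locally_Rabs_lt s e Hs); intros y Hy t _.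
    now apply (polar_derivatives e p px py ps q qx qy qs).
  - intros t _.
    apply (continuous_comp (fun w : R * R => ((fst w, rho), snd w))
      (fun w : R * R * R => polar ps qs (fst (fst w)) (snd (fst w)) (snd w)) (s, t)).
    + repeat apply continuous_pair;
        [ apply continuous_fst | apply continuous_const | apply continuous_snd ].
    + apply polar_continuous; intros x y -> ->.
      destruct (polar_in_cube rho t e Hr); split; [ now apply Hp | now apply Hq ].
  - apply filter_imp with (2 := locally_Rabs_lt s e Hs); intros y Hy t _.
    apply (ex_derive_continuous (V := R_NormedModule)); eexists.
    now apply (polar_derivatives e p px py ps q qx qy qs).
Qed.

Lemma circle_int_ds_continuous (e : R) (p px py ps q qx qy qs : R -> R -> R -> R) (s rho : R) :
  C1_cube e p px py ps -> C1_cube e q qx qy qs -> Rabs s < e -> Rabs rho < e ->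
  continuous (fun w : R * R => circle_int ps qs (fst w) (snd w)) (s, rho).
Proof.
  intros Hp Hq Hs Hr; generalize two_PI_pos; intros HPI.
  apply (continuous_RInt_param (fun (w : R * R) t => polar ps qs (fst w) (snd w) t));
    [ lra | ].
  apply filter_imp with (2 := locally_pair_Rabs_lt s rho e Hs Hr).
  intros [y r] [Hy Hr'] t _.
  apply (polar_continuous ps qs y r t); intros x z -> ->.
  destruct (polar_in_cube r t e Hr'); split; [ now apply Hp | now apply Hq ].
Qed.

(* In polar coordinates [2 rho d/d(bar z) = e^(i t) (rho d/d rho + i d/dt)], and
   the [t]-derivative integrates to zero over the circle. *)
Lemma is_derive_circle_int_rho (e : R) (p px py ps q qx qy qs : R -> R -> R -> R)
    (f : R -> R) (s rho : R) :
  C1_cube e p px py ps -> C1_cube e q qx qy qs -> Rabs s < e -> Rabs rho < e ->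
  (forall x y, Rabs x < e -> Rabs y < e ->
    / 2 * (px x y s - qy x y s) + x * qs x y s + y * ps x y s = f s) ->
  is_derive (fun r => r * circle_int p q s r) rho
    (4 * PI * rho * f s
     - 2 * (rho * rho) * circle_int qs (fun x y s => - ps x y s) s rho).
Proof.
  intros Hp Hq Hs Hr Heq; generalize two_PI_pos; intros HPI.
  assert (Hnp := C1_cube_opp _ _ _ _ _ Hp).
  set (drho := fun r t => polar px qx s r t * cos t + polar py qy s r t * sin t).
  assert (Cdrho : forall t, continuous (fun w : R * R => drho (fst w) (snd w)) (rho, t)).
  { intros t; destruct (polar_in_cube rho t e Hr) as [Hx Hy].
    assert (Hcomp : forall g h : R -> R -> R -> R,
      continuous (fun w : R * R * R => polar g h (fst (fst w)) (snd (fst w)) (snd w))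
        (s, rho, t) ->
      continuous (fun w : R * R => polar g h s (fst w) (snd w)) (rho, t)).
    { intros g h.
      apply (continuous_comp (fun w : R * R => ((s, fst w), snd w))
        (fun w : R * R * R => polar g h (fst (fst w)) (snd (fst w)) (snd w)) (rho, t)).
      repeat apply continuous_pair;
        [ apply continuous_const | apply continuous_fst | apply continuous_snd ]. }
    unfold drho; apply continuous_Rplus; apply continuous_Rmult.
    - apply Hcomp, polar_continuous; intros x y -> ->.
      split; [ now apply Hp | now apply Hq ].
    - prove_continuous.
    - apply Hcomp, polar_continuous; intros x y -> ->.
      split; [ now apply Hp | now apply Hq ].
    - prove_continuous. }
  assert (Cpolar : forall r t, Rabs r < e -> continuous (polar p q s r) t).
  { intros r t Hr'; apply (ex_derive_continuous (V := R_NormedModule)); eexists.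
    now apply (polar_derivatives e p px py ps q qx qy qs). }
  assert (D : is_derive (circle_int p q s) rho (RInt (drho rho) 0 (2 * PI))).
  { apply (is_derive_RInt_param_margin (polar p q s) drho 0 (2 * PI) 1 rho); try lra.
    - apply filter_imp with (2 := locally_Rabs_lt rho e Hr); intros r Hr' t _.
      now apply (polar_derivatives e p px py ps q qx qy qs).
    - intros t _; apply Cdrho.
    - apply filter_imp with (2 := locally_Rabs_lt rho e Hr); auto. }
  set (Q := polar q (fun x y s => - p x y s) s rho).
  set (Qs := polar qs (fun x y s => - ps x y s) s rho).
  assert (CQs : forall t, continuous Qs t).
  { intros t; destruct (polar_in_cube rho t e Hr) as [Hx Hy].
    apply (continuous_section (fun (w : R * R) t =>
             polar qs (fun x y s => - ps x y s) (fst w) (snd w) t) (s, rho) t).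
    apply polar_continuous; intros x y -> ->.
    split; [ now apply Hq | now apply Hnp ]. }
  (* The equation for [u], multiplied by [2 rho] so that it survives at [rho = 0], and solved for
     the [t]-derivative of [Im (e^(i t) u)]. The first two terms form the [rho]-derivative of
     [rho Re (e^(i t) u)], which is why the circle integral carries a factor [rho]. *)
  assert (DQ : forall t, is_derive Q t
     (rho * drho rho t + polar p q s rho t + 2 * (rho * rho) * Qs t - 2 * rho * f s)).
  { intros t; destruct (polar_in_cube rho t e Hr) as [Hx Hy].
    eapply is_derive_eq.
    - now apply (polar_derivatives e q qx qy qs (fun x y s => - p x y s)
        (fun x y s => - px x y s) (fun x y s => - py x y s) (fun x y s => - ps x y s)).
    - assert (Hcs : cos t * cos t = 1 - sin t * sin t)
        by (generalize (sin2_cos2 t); unfold Rsqr; lra).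
      unfold drho, Qs, polar.
      replace (2 * rho * f s) with (rho * (2 * f s)) by ring.
      replace (2 * f s) with (px (rho * cos t) (rho * sin t) s - qy (rho * cos t) (rho * sin t) s
        + 2 * (rho * cos t * qs (rho * cos t) (rho * sin t) s
               + rho * sin t * ps (rho * cos t) (rho * sin t) s))
        by (rewrite <- (Heq _ _ Hx Hy); field).
      ring [Hcs]. }
  assert (Hzero : is_RInt (fun t => rho * drho rho t + polar p q s rho t
            + 2 * (rho * rho) * Qs t - 2 * rho * f s) 0 (2 * PI) 0).
  { replace 0 with (minus (Q (2 * PI)) (Q 0)) at 2.
    - apply (is_RInt_derive (V := R_CompleteNormedModule)); intros t _; [ apply DQ | ].
      apply continuous_Rminus; [ | apply continuous_const ].
      apply continuous_Rplus; [ apply continuous_Rplus | ].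
      + apply continuous_Rmult; [ apply continuous_const | ].
        apply (continuous_section drho), Cdrho.
      + now apply Cpolar.
      + apply continuous_Rmult; [ apply continuous_const | apply CQs ].
    - unfold Q, polar; rewrite cos_2PI, sin_2PI, cos_0, sin_0.
      unfold minus, plus, opp; simpl; ring. }
  assert (Hint : forall g : R -> R, (forall t, continuous g t) ->
     is_RInt g 0 (2 * PI) (RInt g 0 (2 * PI))).
  { intros g Hg; apply (RInt_correct (V := R_CompleteNormedModule)).
    apply (ex_RInt_continuous (V := R_CompleteNormedModule)); auto. }
  assert (I1 := Hint (drho rho) (fun t => continuous_section drho _ _ (Cdrho t))).
  assert (I2 := Hint (polar p q s rho) (fun t => Cpolar rho t Hr)).
  assert (I3 := Hint Qs CQs).
  assert (I4 := is_RInt_const (V := R_NormedModule) 0 (2 * PI) (2 * rho * f s)).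
  assert (Hsum := is_RInt_minus _ _ _ _ _ _
     (is_RInt_plus _ _ _ _ _ _
        (is_RInt_plus _ _ _ _ _ _ (is_RInt_scal _ _ _ rho _ I1) I2)
        (is_RInt_scal _ _ _ (2 * (rho * rho)) _ I3)) I4).
  assert (Hval := eq_trans (eq_sym (is_RInt_unique (V := R_CompleteNormedModule) _ _ _ _ Hsum))
     (is_RInt_unique (V := R_CompleteNormedModule) _ _ _ _ Hzero)).
  unfold minus, plus, opp, scal in Hval; simpl in Hval; unfold mult in Hval; simpl in Hval.
  eapply is_derive_eq.
  - apply is_derive_Rmult; [ apply is_derive_id | exact D ].
  - unfold circle_int; fold Qs; unfold one; simpl.
    lra.
Qed.

(* With [u = p + i q], the hypotheses say [d u / d(bar z) - i z d u / d s = f(s)]. *)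
Lemma Lewy_no_C1_solution (e : R) (p px py ps q qx qy qs : R -> R -> R -> R) (F f : R -> R) :
  0 < e -> C1_cube e p px py ps -> C1_cube e q qx qy qs ->
  (forall x y s, Rabs x < e -> Rabs y < e -> Rabs s < e ->
    / 2 * (px x y s - qy x y s) + x * qs x y s + y * ps x y s = f s) ->
  (forall x y s, Rabs x < e -> Rabs y < e -> Rabs s < e ->
    / 2 * (qx x y s + py x y s) - x * ps x y s + y * qs x y s = 0) ->
  (forall s, is_derive F s (f s)) -> (forall s, continuous f s) ->
  (forall s, s <= 0 -> F s = 0) -> (forall s, 0 < s -> 0 < F s) ->
  (forall s s', s <= s' -> F s <= F s') ->
  False.
Proof.
  intros He Hp Hq Hre Him HF Hf Fneg Fpos Fmono.
  assert (Hnp := C1_cube_opp _ _ _ _ _ Hp).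
  assert (Hnq := C1_cube_opp _ _ _ _ _ Hq).
  set (np := fun x y s => - p x y s) in *.
  set (nps := fun x y s => - ps x y s) in *.
  (* [Y1 + i Y2] is [- i] times the integral of [u dz] over the circle, minus [2 pi i F(s)]. The
     correction absorbs the source term [4 pi rho f(s)] of the radial derivative. *)
  set (Y1 := fun s rho => rho * circle_int p q s rho).
  set (Y2 := fun s rho => rho * circle_int q np s rho - 2 * PI * F s).
  set (Y1s := fun s rho => rho * circle_int ps qs s rho).
  set (Y2s := fun s rho => rho * circle_int qs nps s rho - 2 * PI * f s).
  generalize two_PI_pos; intros HPI.
  assert (Dall : forall s rho, Rabs s < e -> Rabs rho < e ->
    is_derive (fun r => Y1 r rho) s (Y1s s rho) /\
    is_derive (fun r => Y2 r rho) s (Y2s s rho) /\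
    is_derive (Y1 s) rho (- (2 * rho) * Y2s s rho) /\
    is_derive (Y2 s) rho (2 * rho * Y1s s rho) /\
    continuous (fun w : R * R => Y1s (fst w) (snd w)) (s, rho) /\
    continuous (fun w : R * R => Y2s (fst w) (snd w)) (s, rho)).
  { intros s rho Hs Hr.
    assert (D1 := is_derive_circle_int_s e p px py ps q qx qy qs s rho Hp Hq Hs Hr).
    assert (D2 := is_derive_circle_int_s e _ _ _ _ _ _ _ _ s rho Hq Hnp Hs Hr).
    assert (C1 := circle_int_ds_continuous e p px py ps q qx qy qs s rho Hp Hq Hs Hr).
    assert (C2 := circle_int_ds_continuous e _ _ _ _ _ _ _ _ s rho Hq Hnp Hs Hr).
    assert (R1 := is_derive_circle_int_rho e _ _ _ _ _ _ _ _ f s rho Hp Hq Hs Hr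
       (fun x y Hx Hy => Hre x y s Hx Hy Hs)).
    (* The imaginary part of the equation for [u] is the real part of the equation for
       [- i u = q - i p], with zero right-hand side. *)
    assert (R2 := is_derive_circle_int_rho e _ _ _ _ _ _ _ _ (fun _ => 0) s rho Hq Hnp Hs Hr).
    assert (Hopp : circle_int nps (fun x y s => - qs x y s) s rho
        = - circle_int ps qs s rho).
    { unfold circle_int.
      transitivity (RInt (fun t => - polar ps qs s rho t) 0 (2 * PI)).
      - apply RInt_ext; intros t _.
        change (polar nps (fun x y s => - qs x y s) s rho t = - polar ps qs s rho t).
        unfold polar, nps; ring.
      - apply (RInt_opp (V := R_CompleteNormedModule)).
        apply (ex_RInt_continuous (V := R_CompleteNormedModule)); intros t _.
        destruct (polar_in_cube rho t e Hr).
        apply (continuous_section (fun (w : R * R) t => polar ps qs (fst w) (snd w) t)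
          (s, rho) t).
        apply polar_continuous; intros x y -> ->; split; [ now apply Hp | now apply Hq ]. }
    split; [ | split; [ | split; [ | split; [ | split ] ] ] ].
    - eapply is_derive_eq; [ exact (is_derive_scal _ s rho _ D1) | reflexivity ].
    - eapply is_derive_eq.
      + apply is_derive_Rminus; [ exact (is_derive_scal _ s rho _ D2) | ].
        exact (is_derive_scal _ s (2 * PI) _ (HF s)).
      + reflexivity.
    - apply (is_derive_eq _ _ _ _ R1); unfold Y2s, nps; ring.
    - eapply is_derive_eq.
      + apply is_derive_Rminus; [ apply R2 | apply is_derive_const ].
        intros x y Hx Hy; rewrite <- (Him x y s Hx Hy Hs); unfold nps; ring.
      + fold nps; rewrite Hopp; unfold Y1s, zero; simpl; ring.
    - apply continuous_Rmult; [ apply continuous_snd | exact C1 ].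
    - apply continuous_Rminus.
      + apply continuous_Rmult; [ apply continuous_snd | exact C2 ].
      + apply continuous_Rmult; [ apply continuous_const | ].
        apply (continuous_comp fst f); [ apply continuous_fst | apply Hf ]. }
  apply (folded_CR_no_flat_boundary_value e Y1 Y2 Y1s Y2s (fun s => 2 * PI * F s) He).
  - intros s rho Hs Hr.
    destruct (Dall s rho Hs Hr) as (D1 & D2 & D3 & D4 & C1 & C2).
    assert (Hloc := locally_pair_Rabs_lt s rho e Hs Hr).
    repeat (split; [ assumption | ]); split; [ | split; [ | now split ] ].
    (* Joint continuity of [Y1] comes from its continuous [s]-derivative and its [rho]-derivative at
       the point. *)
    + apply (continuous_of_partials Y1 Y1s s rho _) with (2 := D3) (3 := C1).
      apply filter_imp with (2 := Hloc); intros [y r] [Hy Hr']; now apply Dall.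
    + apply (continuous_of_partials Y2 Y2s s rho _) with (2 := D4) (3 := C2).
      apply filter_imp with (2 := Hloc); intros [y r] [Hy Hr']; now apply Dall.
  - intros s _; unfold Y1, Y2; split; ring.
  - intros s Hs; rewrite Fneg by exact Hs; ring.
  - intros s Hs; apply Rmult_lt_0_compat; auto.
  - intros s s' Hs; apply Rmult_le_compat_l; [ lra | auto ].
Qed.

(** * Smooth and analytic coefficients *)

Lemma is_derive_C_intro (f1 f2 : R -> R) (x l1 l2 : R) :
  is_derive f1 x l1 -> is_derive f2 x l2 ->
  is_derive (V := C_R_NormedModule) (fun u => (f1 u, f2 u)) x (l1, l2).
Proof.
  intros H1 H2.
  assert (H : filterdiff (V := prod_NormedModule R_AbsRing R_NormedModule R_NormedModule)
     (fun u => (f1 u, f2 u)) (locally x)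
     (fun y : R => (scal y l1, scal y l2))).
  { apply (filterdiff_comp'_2 (V := R_NormedModule)
      (W := prod_NormedModule R_AbsRing R_NormedModule R_NormedModule)
      f1 f2 (fun u v => (u, v)) x _ _ (fun u v => (u, v)) H1 H2).
    apply filterdiff_linear, is_linear_prod; [ apply is_linear_fst | apply is_linear_snd ]. }
  exact H.
Qed.

Lemma is_derive_C_elim (f : R -> C) (x : R) (l : C) :
  is_derive (V := C_R_NormedModule) f x l ->
  is_derive (fun u => Re (f u)) x (Re l) /\ is_derive (fun u => Im (f u)) x (Im l).
Proof.
  intros H; split.
  - apply (filterdiff_comp' (V := prod_NormedModule R_AbsRing R_NormedModule R_NormedModule)
      (W := R_NormedModule) f fst x (fun y => scal y l) fst H).
    apply filterdiff_linear, is_linear_fst.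
  - apply (filterdiff_comp' (V := prod_NormedModule R_AbsRing R_NormedModule R_NormedModule)
      (W := R_NormedModule) f snd x (fun y => scal y l) snd H).
    apply filterdiff_linear, is_linear_snd.
Qed.

Lemma RCderive_unique (f : R -> C) (x : R) (l : C) :
  is_derive (V := C_R_NormedModule) f x l -> RCderive f x = l.
Proof.
  intros H; apply is_derive_C_elim in H; destruct H as [H1 H2].
  destruct l as [l1 l2]; unfold RCderive; f_equal; now apply is_derive_unique.
Qed.

Lemma RCderive_correct (f : R -> C) (x : R) :
  ex_RCderive f x -> is_derive (V := C_R_NormedModule) f x (RCderive f x).
Proof. intros [l Hl]; now rewrite (RCderive_unique f x l Hl). Qed.

(** The powers [s^(-m)] make the span of the family stable under differentiation. [F] is the member
    [m = 0] and [f = F'] the member [m = 2]. *)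
Definition flat_exp (m : nat) (s : R) : R :=
  if Rle_dec s 0 then 0 else (/ s) ^ m * exp (- / s).

Lemma flat_exp_nonpos (m : nat) (s : R) : s <= 0 -> flat_exp m s = 0.
Proof. unfold flat_exp; now destruct (Rle_dec s 0). Qed.

Lemma flat_exp_eq (m : nat) (s : R) : 0 < s -> flat_exp m s = (/ s) ^ m * exp (- / s).
Proof. unfold flat_exp; destruct (Rle_dec s 0); [ lra | trivial ]. Qed.

Lemma flat_exp_pos (m : nat) (s : R) : 0 < s -> 0 < flat_exp m s.
Proof.
  intros Hs; rewrite flat_exp_eq by assumption.
  apply Rmult_lt_0_compat; [ | apply exp_pos ].
  apply pow_lt; now apply Rinv_0_lt_compat.
Qed.

Lemma flat_exp_0_monotone (s s' : R) : s <= s' -> flat_exp 0 s <= flat_exp 0 s'.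
Proof.
  intros Hs; destruct (Rle_dec s 0) as [H | H].
  - rewrite flat_exp_nonpos by assumption.
    destruct (Rle_dec s' 0) as [H' | H'].
    + rewrite flat_exp_nonpos by assumption; lra.
    + left; apply flat_exp_pos; lra.
  - rewrite !flat_exp_eq by lra; simpl; rewrite !Rmult_1_l.
    destruct Hs as [Hs | ->]; [ | lra ].
    left; apply exp_increasing, Ropp_lt_contravar, Rinv_lt_contravar; nra.
Qed.

(** [x^n / n!] is one term of the Taylor sum, and all terms are nonnegative. *)
Lemma pow_le_exp (n : nat) (x : R) : 0 <= x -> x ^ n <= INR (Factorial.fact n) * exp x.
Proof.
  intros Hx.
  assert (Hterm : forall k, 0 <= x ^ k / INR (Factorial.fact k)).
  { intros k; apply Rdiv_le_0_compat; [ now apply pow_le | apply INR_fact_lt_0 ]. }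
  assert (H : x ^ n / INR (Factorial.fact n) <= exp x).
  { apply Rle_trans with (2 := exp_ge_taylor x n Hx).
    destruct n as [ | n ]; [ simpl; lra | ].
    rewrite tech5; generalize (cond_pos_sum _ n Hterm); lra. }
  assert (Hf := INR_fact_lt_0 n).
  replace (x ^ n) with (INR (Factorial.fact n) * (x ^ n / INR (Factorial.fact n)))
    by (field; lra).
  apply Rmult_le_compat_l; lra.
Qed.

(** [pow_le_exp] at [x = 1 / s] with exponent [m + 2]: the two spare powers leave [s^2], enough for
    a zero derivative at 0. *)
Lemma flat_exp_quadratic (m : nat) (s : R) :
  0 <= flat_exp m s <= INR (Factorial.fact (m + 2)) * (s * s).
Proof.
  assert (Hf := INR_fact_lt_0 (m + 2)).
  destruct (Rle_dec s 0) as [H | H].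
  - rewrite flat_exp_nonpos by assumption; generalize (Rle_0_sqr s); unfold Rsqr; nra.
  - split; [ left; apply flat_exp_pos; lra | ].
    rewrite flat_exp_eq by lra.
    assert (Hi : 0 < / s) by (apply Rinv_0_lt_compat; lra).
    assert (Hp := pow_le_exp (m + 2) (/ s) ltac:(lra)).
    replace ((/ s) ^ m) with ((/ s) ^ (m + 2) * (s * s)) by (rewrite pow_add; field; lra).
    rewrite exp_Ropp.
    apply Rmult_le_reg_r with (exp (/ s)); [ apply exp_pos | ].
    replace ((/ s) ^ (m + 2) * (s * s) * / exp (/ s) * exp (/ s))
      with ((/ s) ^ (m + 2) * (s * s)) by (field; repeat split; first [ apply Rgt_not_eq, exp_pos | lra ]).
    apply Rle_trans with (INR (Factorial.fact (m + 2)) * exp (/ s) * (s * s)); [ | lra ].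
    apply Rmult_le_compat_r; nra.
Qed.

Lemma is_derive_0_of_quadratic (g : R -> R) (K : R) :
  (forall s, Rabs (g s) <= K * (s * s)) -> is_derive g 0 0.
Proof.
  intros Hg; apply is_derive_Reals; intros eps Heps.
  assert (HK : 0 <= K).
  { generalize (Hg 1) (Rabs_pos (g 1)); lra. }
  assert (H0 : g 0 = 0).
  { generalize (Hg 0) (Rabs_pos (g 0)); rewrite Rmult_0_r, Rmult_0_r; intros H1 H2.
    apply Rabs_eq_0; lra. }
  (* [K] may be zero, hence [K + 1]. *)
  assert (Hd : 0 < eps / (K + 1)) by (apply Rdiv_lt_0_compat; lra).
  exists (mkposreal _ Hd); intros h Hh0 Hh; simpl in Hh.
  rewrite Rplus_0_l, H0, !Rminus_0_r; unfold Rdiv; rewrite Rabs_mult, Rabs_inv.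
  assert (Hpos : 0 < Rabs h) by (now apply Rabs_pos_lt).
  apply Rmult_lt_reg_r with (Rabs h); [ exact Hpos | ].
  rewrite Rmult_assoc, Rinv_l, Rmult_1_r by lra.
  apply Rle_lt_trans with (1 := Hg h).
  replace (h * h) with (Rabs h * Rabs h)
    by (rewrite <- Rabs_mult; apply Rabs_right; generalize (Rle_0_sqr h); unfold Rsqr; lra).
  assert (H : Rabs h * (K + 1) < eps).
  { apply Rmult_lt_reg_r with (/ (K + 1)); [ apply Rinv_0_lt_compat; lra | ].
    rewrite Rmult_assoc, Rinv_r, Rmult_1_r by lra; exact Hh. }
  nra.
Qed.

Lemma is_derive_flat_exp (m : nat) (s : R) :
  is_derive (flat_exp m) s (- INR m * flat_exp (m + 1) s + flat_exp (m + 2) s).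
Proof.
  destruct (total_order_T s 0) as [[Hs | ->] | Hs].
  - rewrite !flat_exp_nonpos by lra.
    apply is_derive_ext_loc with (fun _ => 0).
    + assert (Hd : 0 < - s) by lra.
      exists (mkposreal _ Hd); intros y Hy.
      assert (Hy' : Rabs (y - s) < - s) by exact Hy.
      apply Rabs_def2 in Hy'; rewrite flat_exp_nonpos; lra.
    + apply is_derive_eq with 0; [ exact (is_derive_const (K := R_AbsRing) (V := R_NormedModule) 0 s) | ring ].
  - rewrite !flat_exp_nonpos by lra.
    apply is_derive_eq with 0; [ | ring ].
    apply is_derive_0_of_quadratic with (INR (Factorial.fact (m + 2))); intros s.
    destruct (flat_exp_quadratic m s); rewrite Rabs_right; lra.
  - rewrite !flat_exp_eq by lra.
    apply is_derive_ext_loc with (fun y => (/ y) ^ m * exp (- / y)).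
    + exists (mkposreal _ Hs); intros y Hy.
      assert (Hy' : Rabs (y - s) < s) by exact Hy.
      apply Rabs_def2 in Hy'; rewrite flat_exp_eq; lra.
    + auto_derive; [ lra | ].
      (* The derivative of [(/ s) ^ m] involves [pred m], so [m = 0] is separate. *)
      rewrite !pow_add; destruct m as [ | m ]; simpl pred.
      * simpl; field; lra.
      * rewrite <- (tech_pow_Rmult (/ s) m); field; lra.
Qed.

Lemma continuous_flat_exp (m : nat) (s : R) : continuous (flat_exp m) s.
Proof.
  apply (ex_derive_continuous (V := R_NormedModule)); eexists; apply is_derive_flat_exp.
Qed.

(** A class of continuous functions stable under the four partial derivatives is smooth, by
    induction on [k]; no formula for higher derivatives is required. *)
Lemma smooth_on_of_closed (S : (C -> R -> R -> C) -> Prop) (U : C * R * R -> Prop)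
    (f : C -> R -> R -> C) :
  (forall f, S f -> S (Defs.Dx f) /\ S (Dy f) /\ S (Ds f) /\ S (Dt f)) ->
  (forall f z s t, S f -> partials_exist f z s t) ->
  (forall f w, S f -> continuous (U := C_UniformSpace)
     (fun p : C * R * R => f (fst (fst p)) (snd (fst p)) (snd p)) w) ->
  S f -> smooth_on U f.
Proof.
  intros Hcl Hp Hc Hf k; revert f Hf; induction k as [ | k IH ]; intros f Hf; simpl.
  - intros; now apply Hc.
  - split; [ intros; now apply Hp | ].
    destruct (Hcl f Hf) as (? & ? & ? & ?); auto.
Qed.

(** A class containing [A] and stable under partial derivatives. Being affine in [z] and in [t], it
    does without a product rule between its members. *)
Inductive flat_affine : (C -> R -> R -> C) -> Prop :=
  | flat_affine_const (c : C) : flat_affine (fun _ _ _ => c)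
  | flat_affine_z (c : C) : flat_affine (fun z _ _ => Cmult c z)
  | flat_affine_s (m : nat) (r : R) : flat_affine (fun _ s _ => RtoC (r * flat_exp m s))
  | flat_affine_st (m : nat) (r : R) :
      flat_affine (fun _ s t => RtoC (r * (t * flat_exp m s)))
  | flat_affine_plus (f g : C -> R -> R -> C) :
      flat_affine f -> flat_affine g ->
      flat_affine (fun z s t => Cplus (f z s t) (g z s t)).

Definition is_partials (f fx fy fs ft : C -> R -> R -> C) : Prop :=
  forall z s t,
    is_derive (V := C_R_NormedModule) (fun u => f (u, Im z) s t) (Re z) (fx z s t) /\
    is_derive (V := C_R_NormedModule) (fun v => f (Re z, v) s t) (Im z) (fy z s t) /\
    is_derive (V := C_R_NormedModule) (fun r => f z r t) s (fs z s t) /\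
    is_derive (V := C_R_NormedModule) (fun r => f z s r) t (ft z s t).

Lemma is_partials_unique (f fx fy fs ft : C -> R -> R -> C) :
  is_partials f fx fy fs ft -> Defs.Dx f = fx /\ Dy f = fy /\ Ds f = fs /\ Dt f = ft.
Proof.
  intros H; repeat split; extensionality z; extensionality s; extensionality t;
    apply RCderive_unique, (H z s t).
Qed.

Lemma is_partials_exist (f fx fy fs ft : C -> R -> R -> C) (z : C) (s t : R) :
  is_partials f fx fy fs ft -> partials_exist f z s t.
Proof.
  intros H; destruct (H z s t) as (? & ? & ? & ?).
  repeat split; eexists; eassumption.
Qed.

Lemma is_derive_C_components (f : R -> C) (x : R) (l : C) :
  is_derive (fun u => Re (f u)) x (Re l) -> is_derive (fun u => Im (f u)) x (Im l) ->
  is_derive (V := C_R_NormedModule) f x l.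
Proof.
  intros H1 H2.
  apply (is_derive_ext (V := C_R_NormedModule) (fun u => (Re (f u), Im (f u)))).
  - intros u; now destruct (f u).
  - replace l with (Re l, Im l) by (now destruct l).
    now apply is_derive_C_intro.
Qed.

Lemma is_derive_Rconst (c x : R) : is_derive (fun _ => c) x 0.
Proof. exact (is_derive_const (K := R_AbsRing) (V := R_NormedModule) c x). Qed.

Lemma flat_affine_partials (f : C -> R -> R -> C) : flat_affine f ->
  exists fx fy fs ft, is_partials f fx fy fs ft /\
    flat_affine fx /\ flat_affine fy /\ flat_affine fs /\ flat_affine ft.
Proof.
  assert (H0 := flat_affine_const (RtoC 0)).
  assert (Dc : forall (c : C) (x : R), is_derive (V := C_R_NormedModule) (fun _ => c) x (RtoC 0)).
  { intros c x; apply is_derive_C_components;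
      [ exact (is_derive_Rconst (Re c) x) | exact (is_derive_Rconst (Im c) x) ]. }
  assert (Dflat : forall m r s, is_derive (fun s => r * flat_exp m s) s
     (r * (- INR m) * flat_exp (m + 1) s + r * flat_exp (m + 2) s)).
  { intros m r s; eapply is_derive_eq;
      [ exact (is_derive_scal _ s r _ (is_derive_flat_exp m s)) | ].
    ring. }
  assert (DR : forall (g : R -> R) (x l : R), is_derive g x l ->
    is_derive (V := C_R_NormedModule) (fun u => RtoC (g u)) x (RtoC l)).
  { intros g x l Hg; apply is_derive_C_components; [ exact Hg | exact (is_derive_Rconst 0 x) ]. }
  induction 1 as [ c | c | m r | m r | f g Hf IHf Hg IHg ].
  - exists (fun _ _ _ => RtoC 0), (fun _ _ _ => RtoC 0), (fun _ _ _ => RtoC 0),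
      (fun _ _ _ => RtoC 0); 
    split; [ intros z s t; split; [ | split; [ | split ] ] | split; [ | split; [ | split ] ] ];
      first [ exact H0 | apply Dc ].
  - exists (fun _ _ _ => c), (fun _ _ _ => Cmult c Ci), (fun _ _ _ => RtoC 0),
      (fun _ _ _ => RtoC 0).
    split; [ intros z s t; split; [ | split; [ | split ] ] | split; [ | split; [ | split ] ] ];
      try apply flat_affine_const; try apply Dc;
      apply is_derive_C_components; simpl; auto_derive; trivial; unfold Re, Im; ring.
  - exists (fun _ _ _ => RtoC 0), (fun _ _ _ => RtoC 0),
      (fun _ s _ => Cplus (RtoC (r * (- INR m) * flat_exp (m + 1) s))
                          (RtoC (r * flat_exp (m + 2) s))),
      (fun _ _ _ => RtoC 0).
    split; [ intros z s t; split; [ | split; [ | split ] ] | split; [ | split; [ | split ] ] ];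
      try exact H0; try apply Dc.
    + rewrite <- RtoC_plus; apply (DR (fun s => r * flat_exp m s)), Dflat.
    + apply flat_affine_plus; apply flat_affine_s.
  - exists (fun _ _ _ => RtoC 0), (fun _ _ _ => RtoC 0),
      (fun _ s t => Cplus (RtoC (r * (- INR m) * (t * flat_exp (m + 1) s)))
                          (RtoC (r * (t * flat_exp (m + 2) s)))),
      (fun _ s _ => RtoC (r * flat_exp m s)).
    split; [ intros z s t; split; [ | split; [ | split ] ] | split; [ | split; [ | split ] ] ];
      try exact H0; try apply Dc.
    + rewrite <- RtoC_plus; apply (DR (fun s => r * (t * flat_exp m s))).
      eapply is_derive_eq.
      * apply (is_derive_ext (fun s => t * (r * flat_exp m s))); [ | ].
        { intros u; change (t * (r * flat_exp m u) = r * (t * flat_exp m u)); ring. }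
        exact (is_derive_scal _ s t _ (Dflat m r s)).
      * ring.
    + apply (DR (fun t => r * (t * flat_exp m s))); auto_derive; trivial; ring.
    + apply flat_affine_plus; apply flat_affine_st.
    + apply flat_affine_s.
  - destruct IHf as (fx & fy & fs & ft & Pf & ? & ? & ? & ?).
    destruct IHg as (gx & gy & gs & gt & Pg & ? & ? & ? & ?).
    exists (fun z s t => Cplus (fx z s t) (gx z s t)),
      (fun z s t => Cplus (fy z s t) (gy z s t)),
      (fun z s t => Cplus (fs z s t) (gs z s t)),
      (fun z s t => Cplus (ft z s t) (gt z s t)).
    split; [ | repeat split; now apply flat_affine_plus ].
    intros z s t; destruct (Pf z s t) as (? & ? & ? & ?), (Pg z s t) as (? & ? & ? & ?).
    split; [ | split; [ | split ] ]; now apply (is_derive_plus (V := C_R_NormedModule)).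
Qed.

Lemma continuous_C_components {T : UniformSpace} (f : T -> C) (x : T) :
  continuous (fun y => Re (f y)) x -> continuous (fun y => Im (f y)) x ->
  continuous (U := C_UniformSpace) f x.
Proof.
  intros H1 H2.
  apply (continuous_ext (U := C_UniformSpace) (fun y => (Re (f y), Im (f y)))).
  - intros y; now destruct (f y).
  - exact (continuous_pair (fun y => Re (f y)) (fun y => Im (f y)) x H1 H2).
Qed.

Lemma continuous_Re {T : UniformSpace} (f : T -> C) (x : T) :
  continuous (U := C_UniformSpace) f x -> continuous (fun y => Re (f y)) x.
Proof.
  intros H; apply (continuous_comp (V := C_UniformSpace) f Re); [ exact H | ].
  destruct (f x); apply continuous_fst.
Qed.

Lemma continuous_Im {T : UniformSpace} (f : T -> C) (x : T) :
  continuous (U := C_UniformSpace) f x -> continuous (fun y => Im (f y)) x.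
Proof.
  intros H; apply (continuous_comp (V := C_UniformSpace) f Im); [ exact H | ].
  destruct (f x); apply continuous_snd.
Qed.

Lemma continuous_fst' {U V : UniformSpace} (w : U * V) : continuous fst w.
Proof. destruct w; apply continuous_fst. Qed.

Lemma continuous_snd' {U V : UniformSpace} (w : U * V) : continuous snd w.
Proof. destruct w; apply continuous_snd. Qed.

Lemma flat_affine_continuous (f : C -> R -> R -> C) (w : C * R * R) : flat_affine f ->
  continuous (U := C_UniformSpace)
    (fun p : C * R * R => f (fst (fst p)) (snd (fst p)) (snd p)) w.
Proof.
  assert (Cs : continuous (fun p : C * R * R => snd (fst p)) w).
  { apply (continuous_comp fst snd); [ apply continuous_fst' | apply continuous_snd' ]. }
  assert (Cz : continuous (U := C_UniformSpace) (fun p : C * R * R => fst (fst p)) w).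
  { apply (continuous_comp fst (fst : C * R -> C)); apply continuous_fst'. }
  assert (Ct : continuous (fun p : C * R * R => snd p) w) by apply continuous_snd'.
  induction 1 as [ c | c | m r | m r | f g Hf IHf Hg IHg ].
  - apply continuous_const.
  - assert (Cx := continuous_Re _ _ Cz); assert (Cy := continuous_Im _ _ Cz).
    apply continuous_C_components; simpl.
    + apply continuous_Rminus; (apply continuous_Rmult; [ apply continuous_const | assumption ]).
    + apply continuous_Rplus; (apply continuous_Rmult; [ apply continuous_const | assumption ]).
  - apply continuous_C_components; simpl; [ | apply continuous_const ].
    apply continuous_Rmult; [ apply continuous_const | ].
    apply (continuous_comp (fun p : C * R * R => snd (fst p)) (flat_exp m));
      [ exact Cs | apply continuous_flat_exp ].
  - apply continuous_C_components; simpl; [ | apply continuous_const ].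
    apply continuous_Rmult; [ apply continuous_const | ].
    apply continuous_Rmult; [ exact Ct | ].
    apply (continuous_comp (fun p : C * R * R => snd (fst p)) (flat_exp m));
      [ exact Cs | apply continuous_flat_exp ].
  - apply continuous_C_components; simpl.
    + apply continuous_Rplus; now apply continuous_Re.
    + apply continuous_Rplus; now apply continuous_Im.
Qed.

Lemma flat_affine_smooth (U : C * R * R -> Prop) (f : C -> R -> R -> C) :
  flat_affine f -> smooth_on U f.
Proof.
  apply smooth_on_of_closed with (S := flat_affine).
  - intros g Hg.
    destruct (flat_affine_partials g Hg) as (gx & gy & gs & gt & Pg & H).
    now destruct (is_partials_unique g gx gy gs gt Pg) as (-> & -> & -> & ->).
  - intros g z s t Hg.
    destruct (flat_affine_partials g Hg) as (gx & gy & gs & gt & Pg & _).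
    now apply (is_partials_exist g gx gy gs gt).
  - intros; now apply flat_affine_continuous.
Qed.

(** * Analyticity of the polynomial [h] *)

Lemma is_series_finite {K : AbsRing} {V : NormedModule K} (u : nat -> V) (N : nat) :
  (forall n, (N < n)%nat -> u n = zero) -> is_series u (sum_n u N).
Proof.
  intros Hu.
  assert (Hs : forall k, sum_n u (k + N) = sum_n u N).
  { induction k as [ | k IH ]; [ reflexivity | ].
    simpl; rewrite sum_Sn, IH, Hu by lia; apply plus_zero_r. }
  apply filterlim_ext_loc with (fun _ => sum_n u N).
  - exists N; intros n Hn.
    replace n with (n - N + N)%nat by lia; now rewrite Hs.
  - apply filterlim_const.
Qed.

Lemma sum_deg_zero {G : AbelianMonoid} (c : nat -> nat -> nat -> G) (n : nat) :
  (forall i j k, (i + j + k = n)%nat -> c i j k = zero) -> sum_deg c n = zero.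
Proof.
  intros Hc.
  assert (Hz : forall (u : nat -> G) N, (forall i, (i <= N)%nat -> u i = zero) ->
    sum_n u N = zero).
  { intros u N; induction N as [ | N IH ]; intros Hu.
    - rewrite sum_O; apply Hu; lia.
    - rewrite sum_Sn, IH, Hu; [ apply plus_zero_l | lia | intros; apply Hu; lia ]. }
  apply Hz; intros i Hi; apply Hz; intros j Hj; apply Hc; lia.
Qed.

Definition lewy_h (z : C) (s : R) : C := (s, Re z * Re z + Im z * Im z).

(** The Taylor coefficients of [s + i (x^2 + y^2)] at the base point; the expansion stops at total
    degree 2. *)
Definition lewy_h_coef (z0 : C) (s0 : R) (i j k : nat) : C :=
  match i, j, k with
  | 0, 0, 0 => lewy_h z0 s0
  | 1, 0, 0 => (0, 2 * Re z0)
  | 0, 1, 0 => (0, 2 * Im z0)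
  | 0, 0, 1 => RtoC 1
  | 2, 0, 0 => Ci
  | 0, 2, 0 => Ci
  | _, _, _ => RtoC 0
  end.

Lemma lewy_h_coef_zero (z0 : C) (s0 : R) (i j k : nat) :
  (2 < i + j + k)%nat -> lewy_h_coef z0 s0 i j k = RtoC 0.
Proof.
  intros H.
  destruct i as [ | [ | [ | i ] ] ], j as [ | [ | [ | j ] ] ], k as [ | [ | k ] ];
    simpl in H; first [ lia | reflexivity ].
Qed.

Lemma lewy_h_analytic (z0 : C) (s0 : R) : real_analytic_at lewy_h z0 s0.
Proof.
  exists (lewy_h_coef z0 s0), 1; split; [ lra | ]; intros dx dy ds _ _ _; split.
  - eexists; apply is_series_finite with (N := 2%nat); intros n Hn.
    apply sum_deg_zero; intros i j k Hk.
    rewrite lewy_h_coef_zero, Cmod_0 by lia; apply Rmult_0_l.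
  - match goal with |- is_series ?u ?l => replace l with (sum_n u 2) end.
    + apply is_series_finite; intros n Hn.
      apply sum_deg_zero; intros i j k Hk.
      rewrite lewy_h_coef_zero by lia; apply Cmult_0_l.
    + unfold sum_deg; rewrite !sum_Sn, !sum_O; simpl.
      repeat rewrite ?sum_Sn, ?sum_O; simpl.
      destruct z0 as [x0 y0]; unfold lewy_h; simpl.
      apply injective_projections; simpl; unfold plus; simpl; ring.
Qed.

(** This is [- i z + t F'(s)]; the factor [1] makes the second summand an instance of
    [flat_affine_st]. *)
Definition lewy_A (z : C) (s t : R) : C :=
  Cplus (Cmult (Copp Ci) z) (RtoC (1 * (t * flat_exp 2 s))).

Lemma lewy_h_derivatives (z : C) (s : R) :
  is_derive (V := C_R_NormedModule) (fun u : R => lewy_h (u, Im z) s) (Re z) (0, 2 * Re z) /\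
  is_derive (V := C_R_NormedModule) (fun v : R => lewy_h (Re z, v) s) (Im z) (0, 2 * Im z) /\
  is_derive (V := C_R_NormedModule) (fun r : R => lewy_h z r) s (RtoC 1).
Proof.
  unfold lewy_h; simpl.
  split; [ | split ]; apply is_derive_C_intro; auto_derive; trivial; ring.
Qed.

(** [d/d(bar z)] of [i |z|^2] is [i z], which cancels [- i z] times the [s]-derivative 1; the flat
    term vanishes at [t = 0]. *)
Lemma lewy_L0 (z : C) (s : R) : L0op lewy_A lewy_h z s = RtoC 0.
Proof.
  destruct (lewy_h_derivatives z s) as (D1 & D2 & D3).
  apply RCderive_unique in D1, D2, D3.
  unfold L0op, dzbar; rewrite D1, D2, D3.
  destruct z as [x y]; unfold lewy_A; apply injective_projections; simpl; field.
Qed.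

Lemma is_derive_h_plus_Cmult (h f : R -> C) (c : R) (x : R) (dh df : C) :
  is_derive (V := C_R_NormedModule) h x dh -> is_derive (V := C_R_NormedModule) f x df ->
  is_derive (V := C_R_NormedModule) (fun u : R => Cplus (h u) (Cmult (RtoC c) (f u))) x
    (Cplus dh (Cmult (RtoC c) df)).
Proof.
  intros Hh Hf; apply is_derive_C_elim in Hh, Hf; destruct Hh, Hf.
  apply is_derive_C_components.
  - apply (is_derive_ext (fun u => Re (h u) + c * Re (f u))).
    { intros u; simpl; unfold Re; simpl; ring. }
    eapply is_derive_eq.
    + apply is_derive_Rplus; [ eassumption | ].
      apply (is_derive_scal (fun u => Re (f u)) x c); eassumption.
    + simpl; unfold Re; ring.
  - apply (is_derive_ext (fun u => Im (h u) + c * Im (f u))).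
    { intros u; simpl; unfold Im; simpl; ring. }
    eapply is_derive_eq.
    + apply is_derive_Rplus; [ eassumption | ].
      apply (is_derive_scal (fun u => Im (f u)) x c); eassumption.
    + simpl; unfold Im; ring.
Qed.

(** The whole expression has a factor [t]: the part from [h] alone reduces to [t F'(s)], the
    isolated [flat_exp 2 s]. As [B = 0], the [t]-derivative of [t g] never has to be computed. *)
Lemma Lop_lewy (g : C -> R -> R -> C) (x y s t : R) : partials_exist g (x, y) s t ->
  let a := Defs.Dx g (x, y) s t in
  let b := Dy g (x, y) s t in
  let c := Ds g (x, y) s t in
  Lop lewy_A (fun _ _ _ => RtoC 0) (fun w r v => Cplus (lewy_h w r) (Cmult (RtoC v) (g w r v)))
    (x, y) s t =
  (t * (/ 2 * (Re a - Im b) + (y + t * flat_exp 2 s) * Re c + x * Im c + flat_exp 2 s),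
   t * (/ 2 * (Im a + Re b) + (y + t * flat_exp 2 s) * Im c - x * Re c)).
Proof.
  intros (Ex & Ey & Es & _) a b c.
  apply RCderive_correct in Ex, Ey, Es.
  destruct (lewy_h_derivatives (x, y) s) as (D1 & D2 & D3).
  assert (P1 := is_derive_h_plus_Cmult _ _ t _ _ _ D1 Ex).
  assert (P2 := is_derive_h_plus_Cmult _ _ t _ _ _ D2 Ey).
  assert (P3 := is_derive_h_plus_Cmult _ _ t _ _ _ D3 Es).
  apply RCderive_unique in P1, P2, P3; simpl in P1, P2, P3.
  unfold Lop, dzbar, Ds at 1; cbv beta; change (Re (x, y)) with x; change (Im (x, y)) with y.
  rewrite P1, P2, P3, Cmult_0_r, Cmult_0_l, Cplus_0_r.
  change (RCderive (fun u => g (u, y) s t) x) with a.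
  change (RCderive (fun v => g (x, v) s t) y) with b.
  change (RCderive (fun r => g (x, y) r t) s) with c.
  clearbody a b c; destruct a as [a1 a2], b as [b1 b2], c as [c1 c2]; unfold lewy_A.
  apply injective_projections; simpl; field.
Qed.

(** * Passage to the limit [t = 0] and conclusion *)

Lemma continuous_zero_at (phi : R -> R) (e : R) : 0 < e -> continuous phi 0 ->
  (forall t, t <> 0 -> Rabs t < e -> phi t = 0) -> phi 0 = 0.
Proof.
  intros He Hc Hphi; apply NNPP; intros Hn.
  assert (Hpos : 0 < Rabs (phi 0)) by (now apply Rabs_pos_lt).
  destruct (Hc (ball (phi 0) (mkposreal _ Hpos)) (locally_ball _ _)) as [d Hd].
  assert (Hm : 0 < Rmin d e / 2).
  { generalize (Rmin_pos d e (cond_pos d) He); lra. }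
  assert (Hmd := Rmin_l d e); assert (Hme := Rmin_r d e).
  set (t := Rmin d e / 2) in *.
  assert (Htd : t < d) by (unfold t in *; lra).
  assert (Hte : t < e) by (unfold t in *; lra).
  assert (Ht : Rabs t = t) by (apply Rabs_right; left; exact Hm).
  assert (Hball : Rabs (phi t - phi 0) < Rabs (phi 0)).
  { apply (Hd t); change (Rabs (t - 0) < d); rewrite Rminus_0_r; lra. }
  rewrite (Hphi t), Rminus_0_l, Rabs_Ropp in Hball.
  - lra.
  - apply Rgt_not_eq, Hm.
  - lra.
Qed.

Lemma open_contains_cube (V : C * R * R -> Prop) : open V -> V (RtoC 0, 0, 0) ->
  exists e, 0 < e /\ forall x y s t, Rabs x < e -> Rabs y < e -> Rabs s < e -> Rabs t < e ->
    V ((x, y), s, t).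
Proof.
  intros HV H0; destruct (HV _ H0) as [e He].
  exists e; split; [ apply cond_pos | ].
  assert (Hball : forall r, Rabs r < e -> ball 0 e r).
  { intros r Hr; change (Rabs (r - 0) < e); now rewrite Rminus_0_r. }
  intros x y s t Hx Hy Hs Ht; apply He.
  repeat split; simpl; now apply Hball.
Qed.

Theorem proposition1p1p5 :
  exists (U : C * R * R -> Prop) (W : C * R -> Prop)
         (A B : C -> R -> R -> C) (h : C -> R -> C),
    (open U /\ U (RtoC 0, 0, 0) /\ smooth_on U A /\ smooth_on U B) /\
    (open W /\ W (RtoC 0, 0) /\
     (forall (z : C) (s : R), W (z, s) -> U (z, s, 0)) /\
     real_analytic_on W h /\
     (forall (z : C) (s : R), W (z, s) -> L0op A h z s = RtoC 0)) /\
    (forall V : C * R * R -> Prop,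
       open V -> V (RtoC 0, 0, 0) ->
       (forall (z : C) (s t : R), V (z, s, t) -> U (z, s, t) /\ W (z, s)) ->
       ~ exists g : C -> R -> R -> C,
           Ck_on 1 V g /\
           forall (z : C) (s t : R), V (z, s, t) ->
             Lop A B (fun w r v => Cplus (h w r) (Cmult (RtoC v) (g w r v)))
               z s t = RtoC 0).
Proof.
  exists (fun _ => True), (fun _ => True), lewy_A, (fun _ _ _ => RtoC 0), lewy_h.
  split; [ | split ].
  - split; [ apply open_true | ]; split; [ exact I | ]; split.
    + apply flat_affine_smooth, (flat_affine_plus _ _ (flat_affine_z _) (flat_affine_st _ _)).
    + apply flat_affine_smooth, flat_affine_const.
  - split; [ apply open_true | ]; split; [ exact I | ]; split; [ trivial | ]; split.
    + intros z s _; apply lewy_h_analytic.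
    + intros z s _; apply lewy_L0.
  - intros V HV HV0 _ (g & [Hpart (Cx & Cy & Cs & _)] & Hsol).
    destruct (open_contains_cube V HV HV0) as (e & He & Hcube).
    assert (R0 : Rabs 0 < e) by (now rewrite Rabs_R0).
    simpl in Cx, Cy, Cs.
    assert (Cslice : forall G : C -> R -> R -> C,
      (forall z s t, V (z, s, t) -> continuous (U := C_UniformSpace)
         (fun p : C * R * R => G (fst (fst p)) (snd (fst p)) (snd p)) (z, s, t)) ->
      forall x y s, Rabs x < e -> Rabs y < e -> Rabs s < e ->
      continuous (U := C_UniformSpace)
        (fun p : R * R * R => G (fst p) (snd p) 0) (x, y, s) /\
      continuous (U := C_UniformSpace) (fun t => G (x, y) s t) 0).
    { intros G HG x y s Hx Hy Hs.
      assert (H := HG (x, y) s 0 (Hcube x y s 0 Hx Hy Hs R0)); split.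
      - exact (continuous_section_l (U := R_UniformSpace) (V := C_UniformSpace)
          (fun (p : C * R) t => G (fst p) (snd p) t) (x, y, s) 0 H).
      - exact (continuous_section (V := C_UniformSpace)
          (fun (p : C * R) t => G (fst p) (snd p) t) (x, y, s) 0 H). }
    assert (Heq : forall x y s, Rabs x < e -> Rabs y < e -> Rabs s < e ->
      let a := Defs.Dx g (x, y) s 0 in
      let b := Dy g (x, y) s 0 in
      let c := Ds g (x, y) s 0 in
      / 2 * (Re a - Im b) + y * Re c + x * Im c + flat_exp 2 s = 0 /\
      / 2 * (Im a + Re b) + y * Im c - x * Re c = 0).
    { intros x y s Hx Hy Hs a b c.
      destruct (Cslice _ Cx x y s Hx Hy Hs) as [_ Ca].
      destruct (Cslice _ Cy x y s Hx Hy Hs) as [_ Cb].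
      destruct (Cslice _ Cs x y s Hx Hy Hs) as [_ Cc].
      assert (Ca1 := continuous_Re _ _ Ca); assert (Ca2 := continuous_Im _ _ Ca).
      assert (Cb1 := continuous_Re _ _ Cb); assert (Cb2 := continuous_Im _ _ Cb).
      assert (Cc1 := continuous_Re _ _ Cc); assert (Cc2 := continuous_Im _ _ Cc).
      (* For [t <> 0] the factor [t] of [Lop_lewy] cancels. Continuity of the first derivatives of
         [g] then carries both equations to [t = 0]. *)
      assert (Hpt : forall t, t <> 0 -> Rabs t < e ->
        let a := Defs.Dx g (x, y) s t in
        let b := Dy g (x, y) s t in
        let c := Ds g (x, y) s t in
        / 2 * (Re a - Im b) + (y + t * flat_exp 2 s) * Re c + x * Im c + flat_exp 2 s = 0 /\
        / 2 * (Im a + Re b) + (y + t * flat_exp 2 s) * Im c - x * Re c = 0).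
      { intros t Ht0 Ht; assert (Hin := Hcube x y s t Hx Hy Hs Ht).
        assert (H := Hsol _ _ _ Hin).
        rewrite (Lop_lewy g x y s t (Hpart _ _ _ Hin)) in H.
        split; [ apply (f_equal Re) in H | apply (f_equal Im) in H ]; simpl in H;
          apply Rmult_integral in H; now destruct H. }
      assert (Z1 := continuous_zero_at (fun t =>
         / 2 * (Re (Defs.Dx g (x, y) s t) - Im (Dy g (x, y) s t))
         + (y + t * flat_exp 2 s) * Re (Ds g (x, y) s t)
         + x * Im (Ds g (x, y) s t) + flat_exp 2 s) e He).
      assert (Z2 := continuous_zero_at (fun t =>
         / 2 * (Im (Defs.Dx g (x, y) s t) + Re (Dy g (x, y) s t))
         + (y + t * flat_exp 2 s) * Im (Ds g (x, y) s t)
         - x * Re (Ds g (x, y) s t)) e He).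
      cbv beta in Z1, Z2; rewrite Rmult_0_l, Rplus_0_r in Z1, Z2.
      split; [ apply Z1 | apply Z2 ]; try (intros; now apply Hpt); prove_continuous. }
    set (slice := fun (part : C -> R) (G : C -> R -> R -> C) (x y s : R) =>
                    part (G (x, y) s 0)).
    assert (Hcube_part : forall part : C -> R,
      (forall (f : R -> C) x l, is_derive (V := C_R_NormedModule) f x l ->
         is_derive (fun u => part (f u)) x (part l)) ->
      (forall (f : R * R * R -> C) x, continuous (U := C_UniformSpace) f x ->
         continuous (fun y => part (f y)) x) ->
      C1_cube e (slice part g) (slice part (Defs.Dx g)) (slice part (Dy g))
        (slice part (Ds g))).
    { intros part Hd Hc x y s Hx Hy Hs.
      destruct (Hpart _ _ _ (Hcube x y s 0 Hx Hy Hs R0)) as (Ex & Ey & Es & _).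
      apply RCderive_correct in Ex, Ey, Es.
      assert (Hpair : forall (G : C -> R -> R -> C),
        continuous (U := C_UniformSpace) (fun p : R * R * R => G (fst p) (snd p) 0) (x, y, s) ->
        continuous (fun p : R * R * R => slice part G (fst (fst p)) (snd (fst p)) (snd p))
          (x, y, s)).
      { intros G HG; unfold slice.
        apply (continuous_ext (fun p : R * R * R => part (G (fst p) (snd p) 0))).
        - now intros [[u v] r].
        - now apply Hc. }
      split; [ exact (Hd _ _ _ Ex) | ]; split; [ exact (Hd _ _ _ Ey) | ].
      split; [ exact (Hd _ _ _ Es) | ].
      split; [ | split ]; apply Hpair; now apply Cslice. }
    (* The limit equation has [- F'(s)] as its right-hand side for [g]; passing to [u = - g] gives
       the sign in [Lewy_no_C1_solution]. *)
    assert (CRe := C1_cube_opp _ _ _ _ _ (Hcube_part Re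
      (fun f x l H => proj1 (is_derive_C_elim f x l H)) continuous_Re)).
    assert (CIm := C1_cube_opp _ _ _ _ _ (Hcube_part Im
      (fun f x l H => proj2 (is_derive_C_elim f x l H)) continuous_Im)).
    apply (Lewy_no_C1_solution e _ _ _ _ _ _ _ _ (flat_exp 0) (flat_exp 2) He CRe CIm).
    + intros x y s Hx Hy Hs; destruct (Heq x y s Hx Hy Hs) as [H _]; unfold slice; lra.
    + intros x y s Hx Hy Hs; destruct (Heq x y s Hx Hy Hs) as [_ H]; unfold slice; lra.
    + intros s; apply (is_derive_eq _ _ _ _ (is_derive_flat_exp 0 s)); simpl; ring.
    + intros s; apply continuous_flat_exp.
    + intros s; apply flat_exp_nonpos.
    + intros s; apply flat_exp_pos.
    + intros s s'; apply flat_exp_0_monotone.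
Qed.
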